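(* Let $G$ be a connected loopless graph that is neither a Shannon triangle of type $(2,2,2)$ nor a Shannon triangle of type $(2,2,1)$. Then either $G$ is odd $3$-edge-colorable, or $G$ admits an odd $4$-edge-coloring with color set $\{1,2,3,4\}$ such that the color $4$ is used only on a single edge $e$ whose endvertices are incident with a common color $c\in\{1,2,3\}$ (that is, each of the two endvertices of $e$ is incident with some edge of color $c$). In the latter case (when $G$ is not odd $3$-edge-colorable), $\chi'_{\mathrm{odd}}(G\setminus\{e\})=3$.
   Context: All graphs are finite, undirected and loopless, and may have multiple (parallel) edges. A (not necessarily proper) edge-coloring of $G$ with color set $S$ is a map $\varphi:E(G)\to S$. It is an odd $k$-edge-coloring if at most $k$ colors are used and each color class $\varphi^{-1}(c)$ forms an odd graph in the following sense: for every vertex $v$ and every color $c$, the number of edges of color $c$ incident with $v$ is either $0$ or odd. $G$ is odd $k$-edge-colorable if it has an odd $k$-edge-coloring, and $\chi'_{\mathrm{odd}}(G)$ is the least $k$ for which $G$ is odd $k$-edge-colorable. For an edge $e$, $G\setminus\{e\}$ is the graph obtained by deleting $e$ and keeping all vertices. For adjacent vertices $v,w$, the $vw$-bouquet $\mathcal{B}_{vw}$ is the set of all (parallel) edges joining $v$ and $w$. A Shannon triangle is a loopless graph on three pairwise adjacent vertices; it has type $(p,q,r)$ if $p\ge q\ge r$ are the parities of the sizes of its three bouquets, where $2$ denotes an even-sized bouquet and $1$ an odd-sized bouquet. Thus type $(2,2,2)$ means that all three bouquets are even-sized, and type $(2,2,1)$ means that exactly two of the bouquets are even-sized and the third is odd-sized.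 *)

(* Defs.v *)
From mathcomp Require Import all_boot.

Set Implicit Arguments.
Unset Strict Implicit.
Unset Printing Implicit Defensive.

(* Finite loopless multigraphs: edges are objects of their own, so several of
   them may have the same pair of endvertices; looplessness is #|ends e| = 2. *)
Record mgraph := MGraph {
  vertex : finType;
  edge : finType;
  ends : edge -> {set vertex};
  card_ends : forall e, #|ends e| = 2 }.

Section Graph.
Variable G : mgraph.

Definition bouquet (v w : vertex G) : {set edge G} :=
  [set e | ends e == [set v; w]].

Definition adjacent : rel (vertex G) := [rel v w | bouquet v w != set0].

Definition connected_graph : Prop := forall v w, connect adjacent v w.

Definition delete_edge (e : edge G) : mgraph :=
  @MGraph (vertex G) {f : edge G | f != e} (fun f => ends (val f))
    (fun f => card_ends (val f)).

(* 2 stands for even and 1 for odd. *)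
Definition parity_code (n : nat) : nat := if odd n then 1 else 2.

Definition shannon_triangle : Prop :=
  #|vertex G| = 3 /\ (forall v w : vertex G, v != w -> adjacent v w).

Definition shannon_type (p q r : nat) : Prop :=
  [/\ shannon_triangle, r <= q <= p &
      exists u v w : vertex G,
        [/\ uniq [:: u; v; w],
            parity_code #|bouquet u v| = p,
            parity_code #|bouquet v w| = q &
            parity_code #|bouquet u w| = r]].

Definition color_degree (S : finType) (phi : {ffun edge G -> S})
    (v : vertex G) (c : S) : nat :=
  #|[set e : edge G | (v \in ends e) && (phi e == c)]|.

Definition odd_edge_coloring (S : finType) (phi : {ffun edge G -> S}) : bool :=
  [forall v, forall c,
     (color_degree phi v c == 0) || odd (color_degree phi v c)].

(* 'I_k serves as the set of colors; odd_edge_colorableP below shows that this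
   is the same as allowing any color set of which at most k colors are used. *)
Definition odd_edge_colorable (k : nat) : bool :=
  [exists phi : {ffun edge G -> 'I_k}, odd_edge_coloring phi].

Lemma odd_edge_colorableP (k : nat) :
  reflect (exists (S : finType) (phi : {ffun edge G -> S}),
             odd_edge_coloring phi /\ #|[set phi e | e : edge G]| <= k)
          (odd_edge_colorable k).
Proof.
apply: (iffP existsP) => [[phi phiP] | [S [phi [phiP le_k]]]].
  exists 'I_k, phi; split=> //.
  by rewrite -[X in _ <= X]card_ord max_card.
pose A := [set phi e | e : edge G].
have inA e : phi e \in A by apply: imset_f.
pose g e : 'I_k := widen_ord le_k (enum_rank_in (inA e) (phi e)).
have gE e f : (g e == g f) = (phi e == phi f).
  apply/eqP/eqP => [/(congr1 val) /= efE | efE].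
    have /(congr1 (@enum_val _ (mem A))) : enum_rank_in (inA e) (phi e)
      = enum_rank_in (inA f) (phi f) by apply: val_inj.
    by rewrite !enum_rankK_in.
  have rank_ef : enum_rank_in (inA e) (phi e) = enum_rank_in (inA f) (phi f).
    by apply: enum_val_inj; rewrite !enum_rankK_in.
  by apply: val_inj; rewrite /= rank_ef.
exists [ffun e => g e]; apply/forallP=> v; apply/forallP=> c.
case: (pickP (fun e => g e == c)) => [e0 /eqP <- | no_c].
  have -> : color_degree [ffun e => g e] v (g e0) = color_degree phi v (phi e0).
    by apply: eq_card => e; rewrite !inE ffunE gE.
  by move/forallP: phiP => /(_ v)/forallP/(_ (phi e0)).
apply/orP; left; rewrite cards_eq0; apply/eqP/setP=> e.
by rewrite !inE ffunE no_c andbF.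
Qed.

Lemma odd_edge_colorable_exists : exists k, odd_edge_colorable k.
Proof.
exists #|edge G|; apply/existsP; exists [ffun e => enum_rank e].
apply/forallP=> v; apply/forallP=> c.
have: color_degree [ffun e => enum_rank e] v c <= 1.
  rewrite /color_degree -(cards1 (enum_val c)); apply/subset_leq_card/subsetP=> e.
  by rewrite !inE ffunE => /andP[_ /eqP <-]; rewrite enum_rankK.
by case: (color_degree _ _ _) => [|[]].
Qed.

Definition odd_chromatic_index : nat := ex_minn odd_edge_colorable_exists.

(* The colors 1, 2, 3, 4 are the elements 0, 1, 2, 3 of 'I_4. *)
Definition color4 : 'I_4 := ord_max.

Definition single_edge_coloring (phi : {ffun edge G -> 'I_4}) (e : edge G) :
    Prop :=
  [/\ odd_edge_coloring phi,
      forall f, phi f = color4 <-> f = e &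
      exists2 c : 'I_4, c != color4 &
        forall v, v \in ends e -> exists2 f, v \in ends f & phi f = c].

End Graph.

(* Main.v *)
Require Import Defs.
From mathcomp Require Import all_boot all_algebra zify.

Set Implicit Arguments.
Unset Strict Implicit.
Unset Printing Implicit Defensive.

(** The first claim is proved by contradiction: [almost3 G] is its conclusion,
    and the structure of a connected [G] without it is narrowed down to the two
    excluded triangles.

    Everything is linear algebra modulo 2. A set of edges is acyclic when it
    contains no nonempty even set, and [closed_under F U] says that no edge of
    [F] leaves [U], so that the unions of components of [G - v] are the closed
    sets of the edges that avoid [v]. By the Fredholm alternative over F_2,
    a system of equations is solvable unless some dependency between the left
    sides has an odd right side ([fredholm]). It is used twice.

    - [parity_subgraph], applied to [G - v]: if all unions of components of
      [G - v] have even order, the edges of [G - v] split into a graph [H] that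
      is odd at every vertex except [v], and an acyclic [F]. Color 1 is [H].
    - [two_coloring]: the remaining edges [D], those of [F] and those at [v],
      have to be shared by colors 2 and 3. Give a single color at a vertex of
      odd degree, and an odd number of edges of each color at a vertex of
      positive even degree. The dependencies of these equations are the even
      sets that contain all or none of the edges at each vertex of the second
      kind, so an acyclic [D] never obstructs, and an obstruction passes
      through [v]. Giving color 4 to one edge, or exchanging edges between [H]
      and [F], is what removes it.

    If the order of [G] is even, no vertex has to be left out of color 1. If
    some [G - v] has an odd component, [G] falls apart at [v] into two graphs
    of even order, for which two different colors can play the part of color 1
    ([almost3_odd_side]). If [v] has even degree and some bouquet at [v] is
    odd, an obstruction uses an edge of [F], and color 4 on that edge destroys
    it ([almost3_odd_bouquet]). So in a counterexample the order is odd, all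
    components of every [G - v] are even, and all bouquets at a vertex of even
    degree are even. Such a vertex [v] exists, and the only obstruction left is
    the set of all edges at [v] ([almost3_missing]). Varying [F] and the edge
    of color 4 then gives the following.

    - The neighbors of [v] have odd degree, or [G] is a triangle of type
      (2,2,2) ([bad_even_nbr]).
    - If [a] is a neighbor of [v] and [b] another neighbor of [a], then the
      bouquet of [a] and [b] is a cut of [G - v] ([cut_exists]). A smallest cut
      contains a leaf, a neighbor of [v] with a single further neighbor
      ([leaf_in_cut]), and there are at least two leaves.
    - Two leaves in different components of [G - v] lead to a coloring with
      color 4 on an edge between [v] and one of them ([leaf_separated]), and
      two nonadjacent leaves in one component to a coloring with color 4 on
      an edge from a leaf to its further neighbor ([leaf_same_side]).
    - Two adjacent leaves form a component of [G - v]; if there is no other,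
      [G] is a triangle of type (2,2,1).

    For the second claim, deleting the edge of color 4 leaves a coloring with
    three colors, while two colors on [G - e] and a third one on [e] would
    color [G]. *)

(** * Linear systems over the field with two elements *)

Section Fredholm.
Import GRing.Theory.
Local Open Scope ring_scope.

Lemma natr_F2 (n : nat) : n%:R = (odd n)%:R :> 'F_2.
Proof.
rewrite -{1}(odd_double_half n) natrD -muln2 natrM.
by rewrite (_ : 2%:R = 0) ?mulr0 ?addr0 //; apply/val_inj.
Qed.

Lemma F2_bool (c : 'F_2) : c = (c != 0)%:R.
Proof. by case: c => -[|[|[]]] // ?; apply/val_inj. Qed.

Lemma sum_F2 (I : finType) (P : pred I) :
  \sum_(i : I) (P i)%:R = (odd #|[set i | P i]|)%:R :> 'F_2.
Proof.
rewrite -natr_F2 -sum1_card natr_sum [RHS]big_mkcond /=.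
by apply: eq_bigr => i _; rewrite inE; case: (P i).
Qed.

(** Rows [i] are equations, columns [j] are unknowns, and both solutions and
    dependencies are given as sets, namely their supports. It holds because
    a row vector lies in a row space as soon as the cokernel annihilates it. *)
Lemma fredholm (I J : finType) (A : I -> J -> bool) (b : I -> bool) :
  (forall Y : {set I}, (forall j, ~~ odd #|[set i in Y | A i j]|) ->
     ~~ odd #|[set i in Y | b i]|) ->
  exists X : {set J}, forall i, odd #|[set j in X | A i j]| = b i.
Proof.
move=> depP.
pose M : 'M['F_2]_(#|J|, #|I|) :=
  \matrix_(j, i) (A (enum_val i) (enum_val j))%:R.
pose u : 'rV['F_2]_#|I| := \row_i (b (enum_val i))%:R.
have /submxP[D uE] : (u <= M)%MS.
  rewrite submxE; apply/eqP/rowP => k; rewrite !mxE.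
  pose Y := [set i | cokermx M (enum_rank i) k != 0].
  have colE (d : I -> bool) :
      \sum_i (d (enum_val i))%:R * cokermx M i k
      = (odd #|[set i in Y | d i]|)%:R.
    rewrite (reindex _ (onW_bij _ (enum_rank_bij I))) -sum_F2 /=.
    apply: eq_bigr => i _.
    by rewrite enum_rankK [cokermx _ _ _]F2_bool inE -natrM mulnb andbC.
  rewrite (eq_bigr (fun i => (b (enum_val i))%:R * cokermx M i k)); last first.
    by move=> i _; rewrite mxE.
  rewrite colE (negPf (depP _ _)) // => j.
  move/matrixP/(_ (enum_rank j) k): (mulmx_coker M); rewrite !mxE.
  rewrite (eq_bigr (fun i => (A (enum_val i) j)%:R * cokermx M i k)); last first.
    by move=> i _; rewrite mxE enum_rankK.
  rewrite (colE (A^~ j)).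
  by case: odd.
exists [set j | D 0 (enum_rank j) != 0] => i.
move/rowP/(_ (enum_rank i)): uE; rewrite !mxE enum_rankK.
rewrite (reindex _ (onW_bij _ (enum_rank_bij J))) /=.
under eq_bigr do rewrite mxE !enum_rankK [D _ _]F2_bool -natrM mulnb.
rewrite (sum_F2 (fun j => (D 0 (enum_rank j) != 0) && A i j)).
have -> : [set j | (D 0 (enum_rank j) != 0) && A i j]
        = [set j in [set j | D 0 (enum_rank j) != 0] | A i j].
  by apply/setP => j; rewrite !inE.
by case: odd; case: (b i).
Qed.
End Fredholm.

(** * Parity of degrees in sets of edges *)

Lemma odd_sum_card (I : finType) (A : {set I}) (n : I -> nat) :
  odd (\sum_(i in A) n i) = odd #|[set i in A | odd (n i)]|.
Proof.
rewrite (big_morph odd oddD (erefl _)) -sum1_card.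
rewrite (big_morph odd oddD (erefl _)) [RHS]big_mkcond [LHS]big_mkcond /=.
by apply: eq_bigr => i _; rewrite inE; case: (i \in A); case: (odd _).
Qed.

Section EdgeSets.
Variable G : mgraph.
Implicit Types (F D H Y C : {set edge G}) (U Z : {set vertex G}).
Implicit Types (x y v : vertex G) (e f : edge G).

Definition star F x := [set e in F | x \in ends e].
Definition deg F x := #|star F x|.
Definition even_set F := [forall x, ~~ odd (deg F x)].
Definition odd_graph F := [forall x, (deg F x == 0) || odd (deg F x)].
(** Cycles are even, and a nonempty even set contains one, so this says that [F]
    is a forest; stated with even sets it needs no walks. *)
Definition acyclic F :=
  forall F0, F0 \subset F -> even_set F0 -> F0 = set0.
(** Equivalently, [U] is a union of components of the graph with edge set [F].
    Working with all such unions avoids choosing components. *)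
Definition closed_under F U :=
  forall e x y, e \in F -> x \in ends e -> y \in ends e -> (x \in U) = (y \in U).

Lemma endsP e : exists x y, x != y /\ ends e = [set x; y].
Proof. by apply/cards2P; rewrite card_ends. Qed.

Lemma other_end e x : x \in ends e -> exists2 y, y != x & ends e = [set x; y].
Proof.
have [a [b [ab ->]]] := endsP e; rewrite !inE => /orP[]/eqP->.
  by exists b; rewrite // eq_sym.
by exists a; rewrite // setUC.
Qed.

Lemma starE F x e : (e \in star F x) = (e \in F) && (x \in ends e).
Proof. by rewrite inE. Qed.

Lemma degID A F x : deg F x = deg (F :&: A) x + deg (F :\: A) x.
Proof.
rewrite /deg -(cardsID A (star F x)); congr (_ + _); apply: eq_card => e.
  by rewrite !inE andbAC.
by rewrite !inE andbA.
Qed.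

Lemma degB F0 F x : F0 \subset F -> deg F x = deg F0 x + deg (F :\: F0) x.
Proof. by move=> /setIidPr FE; rewrite (degID F0) FE. Qed.

Lemma degU F D x : [disjoint F & D] -> deg (F :|: D) x = deg F x + deg D x.
Proof.
move=> dFD; rewrite (degB (F0 := F)) ?subsetUl //; congr (_ + _).
by rewrite setDUl setDv set0U; congr deg; apply/setDidPl; rewrite disjoint_sym.
Qed.

Lemma deg0 x : deg set0 x = 0.
Proof. by apply/eqP; rewrite cards_eq0; apply/eqP/setP => e; rewrite !inE. Qed.

Lemma deg1 e x : deg [set e] x = (x \in ends e).
Proof.
rewrite /deg; case xe: (x \in ends e).
  rewrite -[RHS](cards1 e); apply: eq_card => f; rewrite !inE.
  by case: eqP => // ->; rewrite xe.
apply/eqP; rewrite cards_eq0; apply/eqP/setP => f; rewrite !inE.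
by case: eqP => // ->; rewrite xe.
Qed.

Lemma deg_gt0P F x : reflect (exists2 e, e \in F & x \in ends e) (0 < deg F x).
Proof.
apply: (iffP card_gt0P) => [[e] | [e eF xe]]; last by exists e; rewrite inE eF.
by rewrite inE => /andP[]; exists e.
Qed.

Lemma deg_eq0 F x : (forall e, e \in F -> x \notin ends e) -> deg F x = 0.
Proof.
move=> no; apply/eqP; rewrite -leqn0 leqNgt; apply/deg_gt0P => -[e eF].
by rewrite (negPf (no _ eF)).
Qed.

Lemma leq_deg F D x : F \subset D -> deg F x <= deg D x.
Proof. by move=> FD; rewrite (degB _ FD) leq_addr. Qed.

Lemma leq_deg_card F x : deg F x <= #|F|.
Proof. by apply/subset_leq_card/subsetP => e; rewrite starE => /andP[]. Qed.

Lemma even_setP F : reflect (forall x, ~~ odd (deg F x)) (even_set F).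
Proof. exact: forallP. Qed.

Lemma even_set0 : even_set set0.
Proof. by apply/even_setP => x; rewrite deg0. Qed.

Lemma even_setD F D : D \subset F -> even_set F -> even_set D -> even_set (F :\: D).
Proof.
move=> DF /even_setP eF /even_setP eD; apply/even_setP => x.
by move: (eF x) (eD x); rewrite (degB x DF) oddD; case: odd.
Qed.

Lemma even_setU F D : [disjoint F & D] ->
  even_set F -> even_set D -> even_set (F :|: D).
Proof.
move=> dFD /even_setP eF /even_setP eD; apply/even_setP => x.
by rewrite degU // oddD (negPf (eF x)) (negPf (eD x)).
Qed.

Lemma handshake F U : closed_under F U -> ~~ odd (\sum_(x in U) deg F x).
Proof.
move=> clU.
have -> : \sum_(x in U) deg F x = \sum_(e in F) #|ends e :&: U|.
  rewrite (eq_bigr (fun x => \sum_(e in F) (x \in ends e))).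
    rewrite exchange_big; apply: eq_bigr => e _.
    rewrite -sum1_card big_mkcond [RHS]big_mkcond /=.
    by apply: eq_bigr => x _; rewrite inE andbC; case: (x \in U); case: (_ \in _).
  move=> x _; rewrite /deg -sum1_card [LHS]big_mkcond [RHS]big_mkcond /=.
  by apply: eq_bigr => e _; rewrite inE; case: (e \in F); case: (_ \in _).
rewrite odd_sum_card (_ : [set e in F | _] = set0) ?cards0 //.
apply/setP => e; rewrite !inE; case eF: (e \in F) => //=.
have [x [y [xy eE]]] := endsP e.
have := clU e x y eF; rewrite eE !inE !eqxx orbT => /(_ isT isT) xyU.
case xU: (x \in U).
  rewrite (setIidPl _) ?cards2 ?xy //.
  by apply/subsetP => z; rewrite !inE => /orP[]/eqP-> //; rewrite -xyU.
rewrite (_ : _ :&: _ = set0) ?cards0 //; apply/setP => z; rewrite !inE.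
by case: eqP => [->|_]; rewrite ?xU //=; case: eqP => [->|]; rewrite // -xyU xU.
Qed.

Lemma closed_odd_vertices F U :
  closed_under F U -> ~~ odd #|[set x in U | odd (deg F x)]|.
Proof. by move/handshake; rewrite odd_sum_card. Qed.

Lemma closedS F D U : F \subset D -> closed_under D U -> closed_under F U.
Proof. by move=> /subsetP FD cl e x y /FD; apply: cl. Qed.

(** A subgraph with prescribed odd vertices [Z] exists when [Z] is even on each
    union of components, since these unions are the dependencies of the degree
    equations. Taken with as many edges as possible it has an acyclic
    complement, because adding an even set keeps all parities. *)
Lemma parity_subgraph D0 Z :
  (forall U, closed_under D0 U -> ~~ odd #|U :&: Z|) ->
  exists F, [/\ F \subset D0, acyclic F
              & forall x, odd (deg (D0 :\: F) x) = (x \in Z)].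
Proof.
move=> clZ; pose pat H := (H \subset D0) && [forall x, odd (deg H x) == (x \in Z)].
have [H0 H0P] : exists H, pat H.
  have [U cl|X XP] := @fredholm _ _ (fun x e => (e \in D0) && (x \in ends e))
                        (fun x => x \in Z).
    have -> : [set x in U | x \in Z] = U :&: Z by apply/setP => x; rewrite !inE.
    apply: clZ.
    move=> e x y eD xe ye; have := cl e; rewrite eD /=.
    have [a [b [ab eE]]] := endsP e.
    have -> : [set i in U | i \in ends e] = [set a; b] :&: U.
      by apply/setP => z; rewrite !inE eE !inE andbC.
    have E (c d : vertex G) : c \in U -> d \notin U -> [set c; d] :&: U = [set c].
      move=> cU dU; apply/setP => z; rewrite !inE.
      case: (z =P c) => [->|] //=; case: (z =P d) => [->|] //=.
      by rewrite (negPf dU).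
    suff abU : ~~ odd #|[set a; b] :&: U| -> (a \in U) = (b \in U).
      move=> /abU abE; move: xe ye; rewrite eE !inE.
      by move=> /orP[]/eqP-> /orP[]/eqP->.
    case: (boolP (a \in U)); case: (boolP (b \in U)) => // bU aU.
      by rewrite E // cards1.
    by rewrite setUC E // cards1.
  exists (X :&: D0); rewrite /pat subsetIr; apply/forallP => x; rewrite -XP.
  apply/eqP; congr odd; apply: eq_card => e; rewrite !inE andbA //.
have [H /andP[HD /forallP HP] Hmax] := arg_maxnP (fun H => #|H|) H0P.
have HE : D0 :\: (D0 :\: H) = H by rewrite setDDr setDv set0U; apply/setIidPr.
exists (D0 :\: H); split=> [|F0 F0s F0e|x]; first exact: subsetDl.
  have dH : [disjoint H & F0].
    rewrite disjoint_sym disjoints_subset (subset_trans F0s) //.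
    by apply/subsetP => e; rewrite !inE => /andP[].
  have /Hmax : pat (H :|: F0).
    rewrite /pat subUset HD (subset_trans F0s) ?subsetDl //=.
    apply/forallP => x; rewrite degU // oddD (negPf (even_setP _ F0e x)).
    by rewrite addbF.
  have /eqP -> : #|H :|: F0| == #|H| + #|F0| by rewrite leq_card_setU.
  by rewrite /= -[leqRHS]addn0 leq_add2l leqn0 cards_eq0 => /eqP.
by rewrite HE; apply/eqP.
Qed.
End EdgeSets.

(** * Sharing edges between two colors *)

Section TwoColoring.
Variable G : mgraph.
Implicit Types (F D H Y C : {set edge G}) (U Z : {set vertex G}).
Implicit Types (x y v p : vertex G) (e f j : edge G).

(** At these vertices both colors of a two-coloring have to occur, each an odd
    number of times; at all other vertices one color takes all edges. *)
Definition evenpos D := [set x | (0 < deg D x) && ~~ odd (deg D x)].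

(** The dependencies between the equations of [two_coloring]. *)
Definition split_cycle D F0 := [&& F0 \subset D, even_set F0 &
  [forall p in evenpos D,
     (star D p \subset F0) || [disjoint star D p & F0]]].

(** The equations with right side one that take part in the dependency [F0]. *)
Definition touched D F0 := [set p in evenpos D | 0 < deg F0 p].

(** The color of an edge is an unknown bit. A vertex of [evenpos D] gives the
    equation that the sum of its edges is one, any other vertex the equations
    that its edges agree with one of them. Summing up the equations of a
    dependency at each vertex of an edge, both ends of the edge get the same
    coefficient, and the edges with coefficient one form a [split_cycle]. *)
Lemma two_coloring D :
  (forall F0, split_cycle D F0 -> ~~ odd #|touched D F0|) ->
  exists C, [/\ C \subset D, odd_graph C & odd_graph (D :\: C)].
Proof.
move=> cycP; pose P := evenpos D.
pose r p e := odflt e [pick e' in star D p].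
have rP p e : e \in star D p -> r p e \in star D p.
  by rewrite /r; case: pickP => // no; rewrite no.
have rI p e e' : e \in star D p -> r p e = r p e'.
  by rewrite /r; case: pickP => // no; rewrite no.
pose A (i : vertex G + vertex G * edge G) j := match i with
  | inl p => (p \in P) && (j \in star D p)
  | inr (p, e) => [&& p \notin P, e \in star D p & (j == e) (+) (j == r p e)]
  end.
pose b (i : vertex G + vertex G * edge G) := if i is inl p then p \in P else false.
have [Y Ycl|X XP] := @fredholm _ _ A b.
  (* [N p j] counts the equations of [Y] at the vertex [p] that involve the edge [j]. *)
  pose N p j := ((inl p \in Y) && A (inl p) j)
    + \sum_(e : edge G) ((inr (p, e) \in Y) && A (inr (p, e)) j).
  have Nstar p j : j \notin star D p -> N p j = 0.
    move=> jp; rewrite /N /= (negPf jp) !andbF big1 // => e _.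
    case ep: (e \in star D p); rewrite ?andbF //=.
    have -> : j == e = false by apply/eqP => je; rewrite je ep in jp.
    have -> : j == r p e = false.
      by apply/eqP => je; rewrite je rP in jp.
    by rewrite !andbF.
  have Nsum j : ~~ odd (\sum_p N p j).
    suff -> : \sum_p N p j = #|[set i in Y | A i j]| by apply: Ycl.
    rewrite /N big_split /= pair_big /= -sum1_card [RHS]big_mkcond big_sumType /=.
    congr (_ + _); apply: eq_bigr; first by move=> p _; rewrite [in RHS]inE; case: andP.
    by case=> p e _; rewrite [in RHS]inE; case: andP.
  have Nends j x y : x \in ends j -> y \in ends j -> odd (N x j) = odd (N y j).
    have [a [c [ac jE]]] := endsP j.
    suff : odd (N a j) = odd (N c j).
      by rewrite jE !inE => E /orP[]/eqP-> /orP[]/eqP->.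
    have := Nsum j; rewrite (bigD1 a) //= (bigD1 c) 1?eq_sym //= big1 ?addn0.
      by rewrite oddD; case: odd; case: odd.
    move=> i /andP[ia ic]; apply: Nstar.
    by rewrite inE jE !inE (negPf ia) (negPf ic) andbF.
  pose F0 := [set j in D | [exists p in ends j, odd (N p j)]].
  have F0E p j : j \in star D p -> (j \in F0) = odd (N p j).
    rewrite !inE => /andP[jD pj]; rewrite jD /=; apply/existsP/idP.
      by case=> x /andP[xj]; rewrite (Nends _ _ _ xj pj).
    by exists p; rewrite pj.
  have F0D : F0 \subset D by apply/subsetP => j; rewrite inE => /andP[].
  have NP p j : p \in P -> j \in star D p -> N p j = (inl p \in Y).
    move=> pP jp; rewrite /N /= pP jp big1 => [|e _]; last by rewrite andbF.
    by rewrite !andbT addn0.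
  have cycF0 : split_cycle D F0.
    apply/and3P; split=> //.
      apply/even_setP => p.
      have -> : deg F0 p = #|[set j in star D p | odd (N p j)]|.
        apply: eq_card => j; rewrite [RHS]in_set [LHS]starE.
        case jp: (j \in star D p); first by rewrite -F0E //= andbC;
          move: jp; rewrite starE => /andP[_ ->].
        apply/negP => /andP[/(subsetP F0D) jD pj].
        by rewrite starE jD pj in jp.
      rewrite -odd_sum_card; case pP: (p \in P).
        rewrite (eq_bigr (fun=> nat_of_bool (inl p \in Y))); last first.
          by move=> j; apply: NP.
        rewrite sum_nat_const oddM negb_and.
        by move: pP; rewrite !inE => /andP[_ ->].
      rewrite (eq_bigr (fun j => \sum_(e : edge G)
         ((inr (p, e) \in Y) && A (inr (p, e)) j : nat))); last first.
        by move=> j _; rewrite /N /= pP !andbF.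
      rewrite exchange_big /= (big_morph odd oddD (erefl _)) big1 // => e _.
      rewrite pP /=; case: (inr _ \in Y); last by rewrite big1_eq.
      case ep: (e \in star D p); last by rewrite big1_eq.
      rewrite odd_sum_card /= (_ : [set _ in _ | _] =
        if e == r p e then set0 else [set e; r p e]).
        by case: ifP; rewrite ?cards0 // cards2 => ->.
      apply/setP => j; rewrite [LHS]in_set oddb.
      case: (e =P r p e) => [<-|/eqP ner]; first by rewrite addbb andbF in_set0.
      rewrite [RHS]in_set2; case: (j =P e) => [->|_].
        by rewrite (negPf ner) ep.
      case: (j =P r p e) => [->|_]; last by rewrite andbF.
      by rewrite rP.
    apply/forall_inP => p pP; case pY: (inl p \in Y).
      by apply/orP; left; apply/subsetP => j jp; rewrite (F0E p) // NP // pY.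
    apply/orP; right; rewrite disjoints_subset; apply/subsetP => j jp.
    by rewrite inE (F0E p) // NP // pY.
  have := cycP _ cycF0; congr (~~ odd _).
  rewrite -(card_imset _ (@inl_inj (vertex G) (vertex G * edge G))).
  apply: eq_card => -[p|i]; last first.
    by rewrite !inE andbF; apply/imsetP => -[].
  rewrite mem_imset; last exact: inl_inj.
  rewrite [LHS]in_set [RHS]in_set /= -/P. case pP: (p \in P); rewrite ?andbF //= !andbT.
 have /card_gt0P[j jp] : 0 < deg D p.
    by move: pP; rewrite inE => /andP[].
  apply/deg_gt0P/idP => [[i iF pi]|pY]; last first.
    exists j; first by rewrite (F0E p) // NP // pY.
    by move: jp; rewrite starE => /andP[].
  have ip : i \in star D p by rewrite starE (subsetP F0D).
  by move: iF; rewrite (F0E p) // NP // oddb.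
have degE p : deg (X :&: D) p = #|X :&: star D p|.
  by apply: eq_card => j; rewrite !inE andbA.
have CD : X :&: D \subset D by apply: subsetIr.
have oddC p : p \in P -> odd (deg (X :&: D) p).
  move=> pP; rewrite degE (_ : odd _ = b (inl p)) // -XP.
  congr odd; apply: eq_card => j; rewrite [LHS]in_setI [RHS]in_set /=.
  by rewrite pP.
have allC p : p \notin P ->
    deg (X :&: D) p = 0 \/ deg (X :&: D) p = deg D p.
  move=> pP; case: (posnP (deg (X :&: D) p)) => [|C0]; [by left | right].
  move: C0; rewrite degE => /card_gt0P[e]; rewrite inE => /andP[eX ep].
  congr #|pred_of_set _|; apply/setIidPr/subsetP.
  have eqr f : f \in star D p -> (f \in X) = (r p f \in X).
    move=> fp; have := XP (inr (p, f)); rewrite /= pP fp /= => E.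
    have [<- //|ner] := eqVneq f (r p f).
    have SE : [set j in X | (j == f) (+) (j == r p f)] = X :&: [set f; r p f].
      apply/setP => j; rewrite !inE.
      by case: (j =P f) => [->|]; rewrite ?(negPf ner).
    move: E; rewrite SE.
    have E1 (c d : edge G) : c \in X -> d \notin X -> X :&: [set c; d] = [set c].
      move=> cU dU; apply/setP => z; rewrite !inE.
      case: (z =P c) => [->|_] /=; first by rewrite cU.
      by case: (z =P d) => [->|_]; rewrite ?(negPf dU) ?andbF.
    case: (boolP (f \in X)); case: (boolP (r p f \in X)) => // a1 a2.
      by rewrite E1 // cards1.
    by rewrite setUC E1 // cards1.
  move=> f fp; rewrite eqr // (rI p f e) // -eqr //.
exists (X :&: D); split=> //; apply/forallP => p.
  have [/oddC cO | pP] := boolP (p \in P); first by rewrite cO orbT.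
  have [->//|->] := allC _ pP; move: pP; rewrite inE.
  by case: (posnP (deg D p)) => //= _; rewrite negbK.
have dE := degB p CD; have [pP | pP] := boolP (p \in P).
  have := oddC _ pP; move: pP; rewrite inE dE oddD => /andP[_].
  by case: odd => //=; case: odd => //; rewrite orbT.
have [C0|C0] := allC _ pP; last by have -> : deg (D :\: (X :&: D)) p = 0 by lia.
have -> : deg (D :\: (X :&: D)) p = deg D p by lia.
move: pP; rewrite inE.
by case: (posnP (deg D p)) => //= _; rewrite negbK.
Qed.

(** The existence part of the theorem. *)
Definition almost3 := odd_edge_colorable G 3 \/
  exists (phi : {ffun edge G -> 'I_4}) (e : edge G), single_edge_coloring phi e.

Definition color_class (phi : edge G -> 'I_4) c := [set e | phi e == c].

Lemma almost3_coloring (phi : edge G -> 'I_4) :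
  (forall c, odd_graph (color_class phi c)) ->
  (forall e f, phi e = color4 -> phi f = color4 -> e = f) ->
  (forall e, phi e = color4 -> exists2 c, c != color4 &
     forall x, x \in ends e -> 0 < deg (color_class phi c) x) ->
  almost3.
Proof.
move=> oddP uniq4 common4.
have degE x c : color_degree (finfun phi) x c = deg (color_class phi c) x.
  by apply: eq_card => e; rewrite !inE ffunE andbC.
have phiP : odd_edge_coloring (finfun phi).
  by apply/forallP => x; apply/forallP => c; rewrite degE; apply: (forallP (oddP c)).
have [e e4|no4] := pickP (fun e => phi e == color4).
  right; exists (finfun phi), e; split=> //.
    move=> f; rewrite ffunE; split=> [f4|->]; last exact/eqP.
    exact: uniq4 f4 (eqP e4).
  have [c c4 cP] := common4 _ (eqP e4); exists c => // x /cP /deg_gt0P[f].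
  by rewrite inE => /eqP fc xf; exists f; rewrite // ffunE.
left; apply/odd_edge_colorableP; exists 'I_4, (finfun phi); split=> //.
have : [set finfun phi e | e : edge G] \subset [set~ color4].
  by apply/subsetP => c /imsetP[e _ ->]; rewrite !inE ffunE no4.
by move/subset_leq_card; rewrite cardsC1 card_ord.
Qed.

(** The values 0, 1, 2, 3 of [c] stand for the colors 1, 2, 3, 4. *)
Lemma almost3_classes (c : edge G -> nat) :
  (forall e, c e < 4) ->
  (forall k, k < 3 -> odd_graph [set e | c e == k]) ->
  #|[set e | c e == 3]| <= 1 ->
  (forall e, c e = 3 -> exists2 k, k < 3 &
     forall x, x \in ends e -> 0 < deg [set e | c e == k] x) ->
  almost3.
Proof.
move=> c_lt oddP c3 common; pose phi e : 'I_4 := inord (c e).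
have phiE e (k : 'I_4) : (phi e == k) = (c e == k).
  by rewrite -val_eqE /= inordK.
have classE (k : 'I_4) : color_class phi k = [set e | c e == k].
  by apply/setP => e; rewrite !inE phiE.
have phi4 e : phi e = color4 <-> c e = 3.
  by split=> [/eqP|E]; [rewrite phiE => /eqP | apply/eqP; rewrite phiE E].
apply: (almost3_coloring (phi := phi)).
- move=> k; rewrite classE; case: (ltnP k 3) => [/oddP // | k3].
  have -> : k = 3 :> nat by have := ltn_ord k; lia.
  apply/forallP => x; suff: deg [set e | c e == 3] x <= 1 by case: deg => [|[]].
  exact: leq_trans (leq_deg_card _ _) c3.
- move=> e f /phi4 e3 /phi4 f3; apply: (card_le1_eqP c3); rewrite !inE ?e3 ?f3 //.
move=> e /phi4 /common[k k3 kP]; exists (inord k).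
  by rewrite -val_eqE /= inordK; lia.
by rewrite classE inordK //; lia.
Qed.

(** The way in which colorings are found: color 1 for the complement of
    [D :|: Y], colors 2 and 3 for [D], color 4 for [Y]. The ends of the edge in
    [Y] share color 1, or both see the colors 2 and 3 when they are in
    [evenpos D]. *)
Lemma almost3_decomposition D Y :
  #|Y| <= 1 -> [disjoint Y & D] -> odd_graph (~: (D :|: Y)) ->
  (forall F0, split_cycle D F0 -> ~~ odd #|touched D F0|) ->
  (forall e, e \in Y ->
     (forall x, x \in ends e -> 0 < deg (~: (D :|: Y)) x) \/
     ends e \subset evenpos D) ->
  almost3.
Proof.
move=> Y1 dYD oddH /two_coloring [C [CD oddC oddDC]] YP.
pose c e := if e \in Y then 3 else if e \in C then 1 else if e \in D then 2 else 0.
have YD e : e \in Y -> e \in D = false by move=> eY; apply: disjointFr dYD eY.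
have YC e : e \in Y -> e \in C = false.
  by move=> eY; apply/negP => /(subsetP CD); rewrite YD.
have DC e : e \in C -> e \in D by apply: (subsetP CD).
have class0 : [set e | c e == 0] = ~: (D :|: Y).
  apply/setP => e; rewrite !inE /c; have := DC e.
  by case: (e \in Y); case: (e \in C); case: (e \in D) => // /(_ isT).
have class1 : [set e | c e == 1] = C.
  apply/setP => e; rewrite !inE /c; have := YC e.
  by case: (e \in Y); case: (e \in C); case: (e \in D) => // /(_ isT).
have class2 : [set e | c e == 2] = D :\: C.
  apply/setP => e; rewrite !inE /c; have := YD e.
  by case: (e \in Y); case: (e \in C); case: (e \in D) => // /(_ isT).
have class3 : [set e | c e == 3] = Y.
  apply/setP => e; rewrite !inE /c.
  by case: (e \in Y); case: (e \in C); case: (e \in D).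
apply: (almost3_classes (c := c)).
- by move=> e; rewrite /c; do 3?case: ifP => _.
- by case=> [|[|[|]]] // _; rewrite ?class0 ?class1 ?class2.
- by rewrite class3.
move=> e; rewrite /c; case: ifP => [eY _|_]; last by do 2?case: ifP => _.
have [eH | eP] := YP _ eY; first by exists 0; rewrite ?class0.
exists 1; rewrite ?class1 // => x /(subsetP eP).
rewrite inE (degB x CD) oddD => /andP[].
have /orP[/eqP-> | ->] := forallP oddDC x; first by rewrite addn0.
by case: (posnP (deg C x)) => // ->.
Qed.
End TwoColoring.

(** * Graphs of even order and odd components *)

Section Cases.
Variable G : mgraph.
Implicit Types (A B F D H Y C : {set edge G}) (U Z X : {set vertex G}).
Implicit Types (x y z v p : vertex G) (e f g : edge G).

Lemma touched0 D : touched D set0 = set0.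
Proof. by apply/setP => p; rewrite !inE deg0 ltnn andbF. Qed.

Lemma acyclic_split_cycle D F0 : acyclic D -> split_cycle D F0 -> ~~ odd #|touched D F0|.
Proof. by move=> acD /and3P[s e _]; rewrite (acD _ s e) touched0 cards0. Qed.

Lemma acyclicS F D : F \subset D -> acyclic D -> acyclic F.
Proof. by move=> FD acD F0 F0F; apply: acD; apply: subset_trans FD. Qed.

(** Their symmetric difference is an even subset of [F]. *)
Lemma acyclic_unique F A B : acyclic F -> even_set A -> even_set B ->
  A :\: B \subset F -> B :\: A \subset F -> A = B.
Proof.
move=> acF eA eB AF BF; have : A :\: B :|: B :\: A = set0.
  apply: acF; first by rewrite subUset AF BF.
  apply/even_setP => x; rewrite degU.
    have := even_setP _ eA x; have := even_setP _ eB x.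
    by rewrite (degID A B) (degID B A) [B :&: A]setIC !oddD; do 3?case: (odd _).
  by rewrite disjoints_subset; apply/subsetP => e; rewrite !inE => /andP[_ ->].
move/eqP; rewrite setU_eq0 !setD_eq0 => /andP[AB BA].
by apply/eqP; rewrite eqEsubset AB BA.
Qed.

(** Connectedness, in terms of closed sets. *)
Definition indecomposable := forall U, closed_under [set: edge G] U -> U = set0 \/ U = setT.

Lemma closedC F U : closed_under F U -> closed_under F (~: U).
Proof. by move=> cl e x y eF xe ye; rewrite !inE (cl e x y). Qed.

(** The graph [D0] on [X] is attached to the rest of the graph at [v] only, so
    a closed set that avoids [v] is closed in the whole graph and hence empty.
    By complementation the remaining closed sets are all of [X]. *)
Lemma parity_side v X D0 : indecomposable -> v \in X ->
  (forall e, e \in D0 -> ends e \subset X) ->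
  (forall e x, e \notin D0 -> x \in ends e -> x \in X -> x = v) ->
  ~~ odd #|X| ->
  exists F, [/\ F \subset D0, acyclic F
              & forall x, odd (deg (D0 :\: F) x) = (x \in X)].
Proof.
move=> conn vX inX outX evX; apply: parity_subgraph => U clU.
have empty U' : closed_under D0 U' -> v \notin U' -> U' :&: X = set0.
  move=> clU' vU'; suff /conn[//|E] : closed_under setT (U' :&: X).
    have : v \in U' :&: X by rewrite E inE.
    by rewrite inE (negPf vU').
  move=> e x y _ xe ye; rewrite !inE; case eD: (e \in D0).
    have /subsetP eX := inX _ eD.
    by rewrite (clU' e x y) // (eX x) // (eX y).
  have out z : z \in ends e -> (z \in U') && (z \in X) = false.
    move=> ze; apply/negP => /andP[zU zX]; move: zU.
    by rewrite (outX e z) ?eD // (negPf vU').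
  by rewrite !out.
have [vU | vU] := boolP (v \in U); last by rewrite (empty U) // cards0.
suff -> : U :&: X = X by [].
have := empty (~: U) (closedC clU); rewrite inE vU => /(_ isT) E.
by apply/setIidPr; rewrite -setD_eq0 setDE setIC E.
Qed.

Lemma almost3_even_order : indecomposable -> ~~ odd #|vertex G| -> almost3 G.
Proof.
move=> conn evV; have [F [_ acF oddH]] : exists F, [/\ F \subset setT, acyclic F
    & forall x, odd (deg (setT :\: F) x) = (x \in setT)].
  apply: parity_subgraph => U /conn[]->; first by rewrite set0I cards0.
  by rewrite setIT cardsT.
apply: (almost3_decomposition (D := F) (Y := set0)).
- by rewrite cards0.
- by rewrite disjoints_subset sub0set.
- by apply/forallP => x; rewrite setU0 -setTD oddH inE orbT.
- by move=> F0; apply: acyclic_split_cycle.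
by move=> e; rewrite inE.
Qed.

Definition edges_at v := star [set: edge G] v.

Lemma edges_atE v e : (e \in edges_at v) = (v \in ends e).
Proof. by rewrite !inE. Qed.

(** By the handshake lemma a single vertex cannot have odd degree. *)
Lemma even_set_except v F : (forall x, x != v -> ~~ odd (deg F x)) -> even_set F.
Proof.
move=> evx; apply/even_setP => x; have [->|/evx //] := eqVneq x v.
have := @closed_odd_vertices G F setT; case vo: (odd (deg F v)) => //= cl.
suff E : [set x in setT | odd (deg F x)] = [set v].
  by move: cl; rewrite E cards1; apply=> e a b _ _ _; rewrite !inE.
apply/setP => y; rewrite !inE /=; have [->//|/evx /negPf->//] := eqVneq y v.
Qed.

(** Let [D1] be the edges inside [v |: U0]. Both [D1] and its complement split
    into an odd spanning graph [H] and a forest [F], as both sides have even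
    order. One side uses color 1 for [H] and colors 2, 3 for [F], the other
    side uses color 2 for [H] and colors 1, 3 for [F]. This works at [v] if all
    forest edges at [v] get color 3, which requires that their number is zero
    or odd; otherwise one of them gets color 4. *)
Lemma almost3_odd_side v U0 : indecomposable -> odd #|vertex G| ->
  v \notin U0 -> closed_under (~: edges_at v) U0 -> odd #|U0| -> almost3 G.
Proof.
move=> conn oddV vU0 clU0 oddU0.
pose D1 := [set e | ends e \subset v |: U0].
have D1P e : e \in D1 -> ends e \subset v |: U0 by rewrite inE.
have D2P e x : e \notin D1 -> x \in ends e -> x \notin U0.
  rewrite inE => eD xe; apply: contra eD => xU.
  have [vz zE] : exists y, ends e = [set x; y] by have [y _ ->] := other_end xe; exists y.
  rewrite zE subUset !sub1set !inE xU orbT /=.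
  have [//|vnz] := eqVneq vz v.
  rewrite -(clU0 e x vz) ?xU ?orbT // ?zE ?inE ?eqxx ?orbT //.
  rewrite zE !inE negb_or eq_sym [v == _]eq_sym vnz andbT.
  by apply: contraNneq vU0 => <-.
have [F1 [F1D acF1 oddH1]] : exists F, [/\ F \subset D1, acyclic F
              & forall x, odd (deg (D1 :\: F) x) = (x \in v |: U0)].
  apply: (parity_side (v := v)); rewrite ?setU11 //; last first.
    by rewrite cardsU1 vU0 /= oddU0.
  by move=> e x /D2P eD /eD; rewrite !inE => /negPf->; rewrite orbF => /eqP.
have [F2 [F2D acF2 oddH2]] : exists F, [/\ F \subset ~: D1, acyclic F
              & forall x, odd (deg (~: D1 :\: F) x) = (x \in ~: U0)].
  apply: (parity_side (v := v)); rewrite ?inE //.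
  - by move=> e; rewrite inE => eD; apply/subsetP => x /(D2P _ _ eD); rewrite inE.
  - move=> e x; rewrite inE negbK => /D1P/subsetP eD /eD.
    by rewrite !inE => /orP[/eqP-> //|->].
  by move: oddV; rewrite -(cardsC U0) oddD oddU0.
have out1 x A : A \subset D1 -> x \notin v |: U0 -> deg A x = 0.
  move=> /subsetP AD xU; apply: deg_eq0 => e /AD/D1P/subsetP eU.
  by apply: contra xU; apply: eU.
have out2 x A : [disjoint A & D1] -> x \in U0 -> deg A x = 0.
  move=> AD xU; apply: deg_eq0 => e eA.
  by apply: contraL xU; apply: D2P; rewrite (disjointFr AD).
have acF : acyclic (F1 :|: F2).
  move=> F0 F0F F0e.
  have F0x x : x != v -> ~~ odd (deg (F0 :&: D1) x) /\ ~~ odd (deg (F0 :\: D1) x).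
    move=> xv; have := even_setP _ F0e x; rewrite (degID D1).
    case xU: (x \in U0).
      have -> := out2 x (F0 :\: D1); rewrite ?addn0 //.
      by rewrite disjoints_subset; apply/subsetP => e; rewrite !inE => /andP[].
    have -> := out1 x (F0 :&: D1); rewrite ?add0n ?subsetIr //.
    by rewrite !inE (negPf xv) xU.
  have s1 : F0 :&: D1 \subset F1.
    apply/subsetP => e; rewrite inE => /andP[/(subsetP F0F)].
    by rewrite inE => /orP[//|/(subsetP F2D)]; rewrite inE => /negPf->.
  have s2 : F0 :\: D1 \subset F2.
    apply/subsetP => e; rewrite inE => /andP[eD /(subsetP F0F)].
    by rewrite inE => /orP[/(subsetP F1D)|//]; rewrite (negPf eD).
  have e1 : F0 :&: D1 = set0.
    by apply: acF1 s1 _; apply: (even_set_except (v := v)) => x /F0x[].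
  have e2 : F0 :\: D1 = set0.
    by apply: acF2 s2 _; apply: (even_set_except (v := v)) => x /F0x[].
  by move: (setID F0 D1); rewrite e1 e2 setU0.
pose F := F1 :|: F2.
have [Y [YF Y1 Dv]] : exists Y, [/\ Y \subset F, #|Y| <= 1 &
    deg (F :\: Y) v = 0 \/ odd (deg (F :\: Y) v)].
  case: (boolP (odd (deg F v))) => [oF|eF].
    by exists set0; rewrite sub0set cards0 setD0; split=> //; right.
  case: (posnP (deg F v)) => [F0|/deg_gt0P[e eF' ve]].
    by exists set0; rewrite sub0set cards0 setD0; split=> //; left.
  exists [set e]; rewrite sub1set cards1; split=> //; right.
  have eF1 : [set e] \subset F by rewrite sub1set.
  by move: eF; rewrite (degB v eF1) oddD deg1 ve negbK.
pose D := F :\: Y.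
have DF : D \subset F by apply: subsetDl.
have [C [CD oddC oddDC Cv]] : exists C, [/\ C \subset D, odd_graph C,
     odd_graph (D :\: C) & deg (D :\: C) v = 0].
  have [F0|C [CD oddC oddDC]] := @two_coloring G D.
    by apply: acyclic_split_cycle; apply: acyclicS acF.
  case: (posnP (deg (D :\: C) v)) => [C0|C1]; first by exists C.
  exists (D :\: C); rewrite subsetDl setDDr setDv set0U (setIidPr CD).
  split=> //; move: Dv; rewrite -/D (degB v CD).
  have /orP[/eqP-> // | o1] := forallP oddC v.
  have := forallP oddDC v; rewrite gtn_eqF //= => o2.
  by rewrite oddD o1 o2 => -[]// /eqP; rewrite addn_eq0 => /andP[/eqP].
pose c e := if e \in Y then 3 else if e \in C then 2 else
  if (e \in D) (+) (e \in D1) then 0 else 1.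
have class2 : [set e | c e == 2] = C.
  apply/setP => e; rewrite !inE /c; case: ifP => [eY|_].
    by apply/esym/negP => /(subsetP CD); rewrite inE eY.
  by case: ifP => // _; case: ifP.
have class3 : [set e | c e == 3] = Y.
  apply/setP => e; rewrite !inE /c; case: ifP => // _.
  by case: ifP => // _; case: ifP.
have FD e : e \in F = (e \in D) || (e \in Y).
  rewrite [e \in D]inE; case eY: (e \in Y); rewrite ?orbF ?orbT //.
  exact: (subsetP YF).
have DY e : e \in D -> e \in Y = false by rewrite inE => /andP[/negPf].
have DC e : e \in C -> e \in D by apply: (subsetP CD).
have class0 : [set e | c e == 0] = (D1 :\: F) :|: (D :\: C :\: D1).
  apply/setP => e; rewrite in_set /c in_setU !in_setD FD.
  have := DC e; have := DY e.
  case: (e \in D); case: (e \in Y); case: (e \in C); case: (e \in D1) => // h1 h2;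
    by [have := h1 isT | have := h2 isT].
have class1 : [set e | c e == 1] = (~: D1 :\: F) :|: ((D :\: C) :&: D1).
  apply/setP => e; rewrite in_set /c in_setU in_setI !in_setD in_setC FD.
  have := DC e; have := DY e.
  case: (e \in D); case: (e \in Y); case: (e \in C); case: (e \in D1) => // h1 h2;
    by [have := h1 isT | have := h2 isT].
have H1E : D1 :\: F = D1 :\: F1.
  apply/setP => e; rewrite !inE negb_or; case: (e \in F1) => //=.
  by case eF2: (e \in F2) => //=; have := subsetP F2D _ eF2; rewrite !inE => /negPf->.
have H2E : ~: D1 :\: F = ~: D1 :\: F2.
  apply/setP => e; rewrite !in_setD in_setU negb_or in_setC.
  case: (e \in F2); rewrite ?andbF //= andbT.
  by case eF1: (e \in F1) => //=; rewrite (subsetP F1D _ eF1).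
have d0 : [disjoint D1 :\: F & D :\: C :\: D1].
  by rewrite disjoints_subset; apply/subsetP => e; rewrite !inE => /andP[_ ->].
have d1 : [disjoint ~: D1 :\: F & (D :\: C) :&: D1].
  by rewrite disjoints_subset; apply/subsetP => e; rewrite !inE => /andP[_ /negPf->]; rewrite andbF.
have odd0 x : x \in v |: U0 -> deg (D :\: C :\: D1) x = 0.
  rewrite !inE => /orP[/eqP->|xU].
    by apply/eqP; rewrite -leqn0 -Cv leq_deg ?subsetDl.
  by apply: out2 => //; rewrite disjoints_subset; apply/subsetP => e; rewrite !inE => /andP[].
have odd1 x : x \notin U0 -> deg ((D :\: C) :&: D1) x = 0.
  move=> xU; have [->|xv] := eqVneq x v.
    by apply/eqP; rewrite -leqn0 -Cv leq_deg ?subsetIl.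
  by apply: out1; rewrite ?subsetIr // !inE (negPf xv).
have splitDC x := degID D1 (D :\: C) x.
apply: (almost3_classes (c := c)).
- by move=> e; rewrite /c; do 3?case: ifP => _.
- case=> [|[|[|]]] // _; rewrite ?class0 ?class1 ?class2 //.
    apply/forallP => x; rewrite degU // H1E.
    have [xU|xU] := boolP (x \in v |: U0).
      by rewrite odd0 // addn0 oddH1 xU orbT.
    rewrite out1 ?subsetDl // add0n; have := forallP oddDC x.
    rewrite splitDC odd1 //; first by rewrite !inE negb_or in xU; case/andP: xU.
  apply/forallP => x; rewrite degU // H2E.
  have [xU|xU] := boolP (x \in U0); last by rewrite odd1 // addn0 oddH2 inE xU orbT.
  rewrite (out2 x (~: D1 :\: F2)) //; last first.
    by rewrite disjoints_subset; apply/subsetP => e; rewrite !inE => /andP[].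
  rewrite add0n; have := forallP oddDC x.
  by rewrite splitDC odd0 ?addn0 // inE xU orbT.
- by rewrite class3.
have pos n : odd n -> 0 < n by case: n.
move=> e _; case eD: (e \in D1).
  exists 0; rewrite ?class0 // => x xe; rewrite degU // ltn_addr // pos // H1E oddH1.
  by apply: (subsetP (D1P _ eD)).
exists 1; rewrite ?class1 // => x xe; rewrite degU // ltn_addr // pos // H2E oddH2.
by rewrite inE (D2P e) ?eD.
Qed.

End Cases.

(** * Leaving out a vertex of even degree *)

Section Missing.
Variable G : mgraph.
Implicit Types (A B F D H Y C : {set edge G}) (U Z X : {set vertex G}).
Implicit Types (x y z v p : vertex G) (e f g : edge G).

Definition nbr v := [set x | (x != v) && (0 < deg (edges_at v) x)].

Lemma deg_edges_at v : deg (edges_at v) v = deg setT v.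
Proof. by apply: eq_card => e; rewrite !inE andbb. Qed.

Lemma deg_off v F : F \subset ~: edges_at v -> deg F v = 0.
Proof.
by move=> /subsetP Fv; apply: deg_eq0 => e /Fv; rewrite inE edges_atE.
Qed.

Lemma star_edges_atU v F : F \subset ~: edges_at v -> star (F :|: edges_at v) v = edges_at v.
Proof.
move=> /subsetP Fv; apply/setP => e; rewrite starE in_setU edges_atE.
case ve: (v \in ends e); rewrite ?orbT ?andbF //.
Qed.

(** All cycles pass through [v], where a split cycle contains all edges or
    none. *)
Lemma split_cycle_missing v F F0 : F \subset ~: edges_at v -> acyclic F ->
  v \in evenpos (F :|: edges_at v) -> split_cycle (F :|: edges_at v) F0 ->
  F0 = set0 \/ edges_at v \subset F0.
Proof.
move=> Fv acF vP /and3P[F0s F0e /forall_inP/(_ _ vP)].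
rewrite star_edges_atU // => /orP[|dis]; [by right | left].
apply: acF F0e; apply/subsetP => e eF0; have := subsetP F0s _ eF0.
by rewrite in_setU (disjointFl dis) ?orbF.
Qed.

Lemma evenpos_missing v F : F \subset ~: edges_at v ->
  (v \in evenpos (F :|: edges_at v)) = (0 < deg (edges_at v) v) && ~~ odd (deg [set: edge G] v).
Proof. by move=> Fv; rewrite inE /deg star_edges_atU // -/(deg _ _) deg_edges_at. Qed.

(** If [F0] obstructs, it contains the edges at [v], so a vertex [u]
    joined to [v] by an odd bouquet forces an edge [f] of [F] into it. Without [f] there is no
    obstruction left: [F0] would be the only candidate. *)
Lemma almost3_odd_bouquet v : ~~ odd (deg [set: edge G] v) ->
  (forall U, closed_under (~: edges_at v) U -> ~~ odd #|U :\ v|) ->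
  ~~ even_set (edges_at v) -> almost3 G.
Proof.
move=> ev clV /forallPn[u]; rewrite negbK => uodd.
have [F [Fs acF oddH]] : exists F, [/\ F \subset ~: edges_at v, acyclic F
    & forall x, odd (deg (~: edges_at v :\: F) x) = (x \in [set~ v])].
  by apply: parity_subgraph => U /clV; rewrite setDE.
have v_pos : 0 < deg (edges_at v) v.
  have /deg_gt0P[e ev' _] : 0 < deg (edges_at v) u by move: uodd; case: deg.
  by apply/deg_gt0P; exists e; rewrite // -edges_atE.
have vP F' : F' \subset ~: edges_at v -> v \in evenpos (F' :|: edges_at v).
  by move=> F's; rewrite evenpos_missing // v_pos.
pose D := F :|: edges_at v.
have HE : ~: D = ~: edges_at v :\: F by rewrite setDE setCU setIC.
have oddHg : odd_graph (~: D).
  apply/forallP => x; rewrite HE oddH !inE.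
  by have [->|] := eqVneq x v; [rewrite deg_off ?subsetDl | rewrite orbT].
case: (boolP [forall F0, split_cycle D F0 ==> ~~ odd #|touched D F0|]).
  move=> /forallP cycP; apply: (almost3_decomposition (D := D) (Y := set0)).
  - by rewrite cards0.
  - by rewrite disjoints_subset sub0set.
  - by rewrite setU0.
  - by move=> F0 /(implyP (cycP F0)).
  - by move=> e; rewrite inE.
move=> /forallPn[F0]; rewrite negb_imply negbK => /andP[cyc0 odd0].
have [F00|vF0] := split_cycle_missing Fs acF (vP _ Fs) cyc0.
  by rewrite F00 touched0 cards0 in odd0.
have /and3P[F0s F0e _] := cyc0.
have [f fF0 fF] : exists2 f, f \in F0 & f \in F.
  have := even_setP _ F0e u; rewrite (degB u vF0) oddD uodd /= negbK => o.
  have /deg_gt0P[f] : 0 < deg (F0 :\: edges_at v) u by move: o; case: deg.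
  rewrite inE => /andP[fv fF0] _; exists f => //.
  by have := subsetP F0s _ fF0; rewrite inE (negPf fv) orbF.
have fv : f \notin edges_at v by have := subsetP Fs _ fF; rewrite inE.
have F's : F :\ f \subset ~: edges_at v by apply: subset_trans Fs; apply: subsetDl.
have acF' : acyclic (F :\ f) by apply: acyclicS acF; apply: subsetDl.
have DE : (F :\ f :|: edges_at v) :|: [set f] = D.
  by rewrite setUAC [_ :\ f :|: _]setUC setD1K.
apply: (almost3_decomposition (D := F :\ f :|: edges_at v) (Y := [set f])).
- by rewrite cards1.
- by rewrite disjoints1 !inE eqxx /= -edges_atE.
- by rewrite DE.
- move=> F1 cyc1; have [->|vF1] := split_cycle_missing F's acF' (vP _ F's) cyc1.
    by rewrite touched0 cards0.
  have /and3P[F1s F1e _] := cyc1.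
  have sub A B : A \subset D -> edges_at v \subset B -> A :\: B \subset F.
    by move=> AD vB; rewrite subDset (subset_trans AD) // /D setUC setSU.
  have F1D : F1 \subset D by rewrite (subset_trans F1s) // /D setSU ?subsetDl.
  have fF1 : f \in F1 by rewrite (acyclic_unique acF F1e F0e) ?sub.
  by have := subsetP F1s _ fF1; rewrite !inE eqxx /= -edges_atE (negPf fv).
move=> e /set1P->; left => x xf; rewrite DE HE.
have : x \in [set~ v].
  by rewrite !inE; apply: contraNneq fv => <-; rewrite edges_atE.
by rewrite -oddH; case: deg.
Qed.

(** As the bouquets at [v] are even, the set of all edges at [v] is the only
    possible nonempty split cycle. It is none if it leaves out an edge at some
    vertex of [evenpos], which is what a positive even degree in [F] achieves.
    Otherwise it touches [v] and the neighbors of [v] that are isolated in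
    [F]. *)
Lemma almost3_missing v Y F :
  even_set (edges_at v) -> #|Y| <= 1 -> F \subset ~: edges_at v -> Y \subset ~: edges_at v ->
  [disjoint Y & F] -> acyclic F ->
  (forall x, x != v -> odd (deg (~: (F :|: edges_at v :|: Y)) x)) ->
  (exists x, [/\ x \in nbr v, 0 < deg F x & ~~ odd (deg F x)]) \/
    odd #|[set x in nbr v | deg F x == 0]| ->
  almost3 G.
Proof.
move=> ev Y1 Fs Ys dYF acF oddH nbrP.
have dinc A : A \subset ~: edges_at v -> [disjoint A & edges_at v] by rewrite disjoints_subset.
have [w wv] : exists w, w \in nbr v.
  case: nbrP => [[x [xv _ _]]|o]; first by exists x.
  have /card_gt0P[x] : 0 < #|[set x in nbr v | deg F x == 0]| by move: o; case: #|_|.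
  by rewrite inE => /andP[xv _]; exists x.
have v_pos : 0 < deg (edges_at v) v.
  move: wv; rewrite inE => /andP[_ /deg_gt0P[e ve _]].
  by apply/deg_gt0P; exists e; rewrite // -edges_atE.
have vP : v \in evenpos (F :|: edges_at v).
  by rewrite evenpos_missing // v_pos -deg_edges_at (even_setP _ ev).
have HvE : deg (~: (F :|: edges_at v :|: Y)) v = 0.
  by apply: deg_off; rewrite setCS -setUA setUCA subsetUl.
apply: (almost3_decomposition (D := F :|: edges_at v) (Y := Y)) => //.
- by rewrite disjoints_subset setCU subsetI Ys -disjoints_subset dYF.
- apply/forallP => x; have [->|/oddH ->] := eqVneq x v; last by rewrite orbT.
  by rewrite HvE.
- move=> F0 cyc; have [->|vF0] := split_cycle_missing Fs acF vP cyc.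
    by rewrite touched0 cards0.
  have /and3P[F0s F0e /forall_inP allF0] := cyc.
  have F0E : F0 = edges_at v.
    apply/eqP; rewrite eqEsubset vF0 andbT -setD_eq0; apply/eqP; apply: acF.
      by rewrite subDset setUC.
    exact: even_setD.
  rewrite F0E in allF0 *.
  have nbrP' x : x \in nbr v -> (x \in evenpos (F :|: edges_at v)) = ~~ odd (deg F x).
    rewrite !inE => /andP[_ x0]; rewrite degU ?dinc // oddD.
    by rewrite (negPf (even_setP _ ev x)) addbF addn_gt0 x0 orbT.
  have zero x : x \in nbr v -> ~~ odd (deg F x) -> deg F x = 0.
    move=> xv ex; case: (posnP (deg F x)) => // /deg_gt0P[e eF xe].
    have := allF0 x; rewrite nbrP' // => /(_ ex)/orP[/subsetP/(_ e)|].
      rewrite starE in_setU eF xe => /(_ isT) ev'.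
      by have := subsetP Fs _ eF; rewrite in_setC ev'.
    move: xv; rewrite inE => /andP[_ /deg_gt0P[f fv xf]].
    rewrite disjoints_subset => /subsetP/(_ f).
    by rewrite starE in_setU xf fv orbT in_setC fv => /(_ isT).
  have oddnb : odd #|[set x in nbr v | deg F x == 0]|.
    by case: nbrP => // -[x [xv x0 ex]]; rewrite (zero _ xv ex) in x0.
  suff -> : touched (F :|: edges_at v) (edges_at v) = v |: [set x in nbr v | deg F x == 0].
    by rewrite cardsU1 !inE eqxx /= oddnb.
  apply/setP => x; rewrite [LHS]in_set in_setU1.
  have [->|xv] := eqVneq x v; first by rewrite vP v_pos.
  rewrite [RHS]/= [RHS]in_set; case xn: (x \in nbr v).
    rewrite nbrP' //; have := xn; rewrite inE xv => /= ->; rewrite andbT /=.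
    by case o: (odd (deg F x)); [case: deg o | rewrite zero ?o].
  by move: xn; rewrite inE xv /= => ->; rewrite andbF.
move=> e eY; left => x xe.
have /oddH : x != v.
  by apply: contraTneq xe => ->; have := subsetP Ys _ eY; rewrite in_setC edges_atE.
by case: deg.
Qed.
End Missing.

(** * Neighbors of a vertex of even degree *)

Section Bouquets.
Variable G : mgraph.
Implicit Types (A B F D H Y C : {set edge G}) (U Z X : {set vertex G}).
Implicit Types (x y z v p t : vertex G) (e f g : edge G).

Definition closedb F U := [forall e in F, forall x in ends e, forall y in ends e,
  (x \in U) == (y \in U)].

Lemma closed_underP F U : reflect (closed_under F U) (closedb F U).
Proof.
apply: (iffP forall_inP) => [cl e x y eF xe ye | cl e eF].
  by have /forall_inP/(_ x xe)/forall_inP/(_ y ye)/eqP := cl e eF.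
by apply/forall_inP => x xe; apply/forall_inP => y ye; apply/eqP/(cl e).
Qed.

Lemma nbrP v x : reflect (x != v /\ exists2 e, v \in ends e & x \in ends e) (x \in nbr v).
Proof.
rewrite inE; case: eqP => xv; first by constructor => -[].
apply: (iffP (deg_gt0P _ _)) => [[e]|[_ [e ve xe]]]; last by exists e; rewrite ?edges_atE.
by rewrite edges_atE => ve xe; split=> //; exists e.
Qed.

Lemma nbrC v x : (x \in nbr v) = (v \in nbr x).
Proof. by apply/nbrP/nbrP => -[xv [e ? ?]]; split; rewrite 1?eq_sym //; exists e. Qed.

Lemma ends_pair e x y : x \in ends e -> y \in ends e -> x != y -> ends e = [set x; y].
Proof.
move=> xe; have [z zx ->] := other_end xe.
by rewrite !inE => /orP[/eqP->|/eqP->//]; rewrite eqxx.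
Qed.

Lemma deg_edges_at_bouquet x y : x != y -> deg (edges_at x) y = #|bouquet x y|.
Proof.
move=> xy; apply: eq_card => e; rewrite starE edges_atE inE.
apply/andP/eqP => [[xe ye]|->]; last by rewrite !inE !eqxx orbT.
exact: ends_pair.
Qed.

Lemma nbr_adjacent x y : (y \in nbr x) = (y != x) && adjacent x y.
Proof.
rewrite inE; case: eqP => //= /eqP yx.
by rewrite deg_edges_at_bouquet 1?eq_sym // card_gt0.
Qed.

Lemma deg_split v F Y x : F \subset ~: edges_at v -> Y \subset ~: edges_at v -> [disjoint Y & F] ->
  deg setT x = deg (edges_at v) x + deg F x + deg Y x + deg (~: (F :|: edges_at v :|: Y)) x.
Proof.
move=> Fv Yv dYF; rewrite (degB x (subsetT (F :|: edges_at v :|: Y))) setTD; congr (_ + _).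
rewrite degU; last first.
  by rewrite disjoint_sym disjoints_subset setCU subsetI Yv -disjoints_subset dYF.
by rewrite degU ?disjoints_subset //; congr (_ + _); rewrite addnC.
Qed.

End Bouquets.

Section BadGraph.
Variable G : mgraph.
Implicit Types (A B F D H Y C : {set edge G}) (U Z X : {set vertex G}).
Implicit Types (x y z v p t : vertex G) (e f g : edge G).

Hypotheses (conn : indecomposable G) (oddV : odd #|vertex G|) (bad : ~ almost3 G).

Local Notation d := (deg [set: edge G]).

Lemma bad_closed v U : closed_under (~: edges_at v) U -> ~~ odd #|U :\ v|.
Proof.
move=> cl; apply/negP => odU; apply: bad.
apply: (almost3_odd_side (v := v) (U0 := U :\ v)) => //; first by rewrite !inE eqxx.
move=> e x y ev xe ye; rewrite !inE (cl e x y) //; congr (_ && _).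
have nv z : z \in ends e -> z != v.
  by apply: contraTneq => ->; move: ev; rewrite in_setC edges_atE.
by rewrite !nv.
Qed.

Lemma bad_even_edges_at v : ~~ odd (d v) -> even_set (edges_at v).
Proof.
move=> ev; apply/negPn/negP => no; apply: bad.
by apply: (almost3_odd_bouquet ev _ no); apply: bad_closed.
Qed.

Section EvenVertex.
Variable v : vertex G.
Hypothesis ev : ~~ odd (d v).

(** The data to which [almost3_missing] applies: [Y] is the edge of color 4, if
    any, and the last condition says that the edges of [G - v] outside of
    [F :|: Y] form an odd graph on all vertices but [v]. *)
Definition missing_join Y F := [/\ #|Y| <= 1, F \subset ~: edges_at v,
  Y \subset ~: edges_at v :\: F, acyclic F &
  forall x, x != v -> odd (deg F x) (+) odd (deg Y x) = ~~ odd (d x)].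

Lemma missing_odd Y F : missing_join Y F ->
  forall x, x != v -> odd (deg (~: (F :|: edges_at v :|: Y)) x).
Proof.
move=> [_ Fv]; rewrite subsetD => /andP[Yv dYF] _ par x xv; have := deg_split x Fv Yv dYF.
move/(congr1 odd); rewrite !oddD (negPf (even_setP _ (bad_even_edges_at ev) x)) /=.
by have := par x xv; case: odd; case: odd; case: odd => //; case: odd.
Qed.

Lemma bad_missing Y F : missing_join Y F ->
  (forall x, x \in nbr v -> 0 < deg F x -> odd (deg F x)) /\
  ~~ odd #|[set x in nbr v | deg F x == 0]|.
Proof.
move=> mj; have oddH := missing_odd mj.
have [Y1 Fv /[!subsetD]/andP[Yv dYF] acF par] := mj.
have G0 := almost3_missing (bad_even_edges_at ev) Y1 Fv Yv dYF acF oddH.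
split=> [x xv x0|]; last by apply/negP => o; apply: bad; apply: G0; right.
by apply/negPn/negP => e; apply: bad; apply: G0; left; exists x.
Qed.

Lemma join_exists Y : #|Y| <= 1 -> Y \subset ~: edges_at v ->
  (forall U, closed_under (~: edges_at v :\: Y) U -> ~~ odd #|U :\ v|) ->
  exists F, missing_join Y F.
Proof.
move=> Y1 Yv cl; have [F [Fs acF oddH]] : exists F,
  [/\ F \subset ~: edges_at v :\: Y, acyclic F
    & forall x, odd (deg (~: edges_at v :\: Y :\: F) x) = (x \in [set~ v])].
  by apply: parity_subgraph => U /cl; rewrite setDE.
move: Fs; rewrite subsetD => /andP[Fv dFY].
exists F; split=> //; first by rewrite subsetD Yv disjoint_sym.
rewrite disjoint_sym in dFY; move=> x xv; have := deg_split x Fv Yv dFY.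
have -> : ~: (F :|: edges_at v :|: Y) = ~: edges_at v :\: Y :\: F.
  apply/setP => e; rewrite !(in_setC, in_setU, in_setD).
  by case: (e \in F); case: (e \in Y); case: (e \in edges_at v).
move/(congr1 odd); rewrite !oddD (negPf (even_setP _ (bad_even_edges_at ev) x)) /= => ->.
by rewrite oddH !inE xv addbT negbK.
Qed.

(** If no neighbor of [v] has positive even degree in [F], the isolated ones are
    those of even degree in [F], and their number depends on [Y] only. *)
Lemma bad_count Y : #|Y| <= 1 -> Y \subset ~: edges_at v ->
  (forall U, closed_under (~: edges_at v :\: Y) U -> ~~ odd #|U :\ v|) ->
  ~~ odd #|[set x in nbr v | odd (d x) (+) odd (deg Y x)]|.
Proof.
move=> Y1 Yv /(join_exists Y1 Yv)[F mj]; have [pos] := bad_missing mj.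
have [_ _ _ _ par] := mj.
congr (~~ odd _); apply: eq_card => x; rewrite !in_set -/(nbr v).
case xv: ((x != v) && _) => //=; have xnb : x \in nbr v by rewrite inE.
have := par x; case/andP: xv => -> _ /(_ isT); have := pos _ xnb.
case: (posnP (deg F x)) => [-> _|p /(_ isT) ->] /=; rewrite ?gtn_eqF //.
  by move->; rewrite addbN addbb.
by case: odd; case: odd.
Qed.

Lemma bad_odd_nbrs : ~~ odd #|[set x in nbr v | odd (d x)]|.
Proof.
have := @bad_count set0; rewrite cards0 sub0set setD0 => /(_ isT isT (@bad_closed v)).
by congr (~~ odd _); apply: eq_card => x; rewrite !inE deg0 addbF.
Qed.

(** Moving from [Y = set0] to [Y = [set f]] changes the parity in [bad_count] by
    the number of ends of [f] next to [v], which is one. So for [Y = [set f]]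
    the required [F] cannot exist, and [f] is a bridge of [G - v]. *)
Lemma bad_bridge f x z : x \in ends f -> z \in ends f -> x \in nbr v ->
  z != v -> z \notin nbr v ->
  exists U, closed_under (~: edges_at v :\ f) U /\ odd #|U :\ v|.
Proof.
move=> xf zf xv zv zn.
have [/existsP[U /andP[/closed_underP cl o]]|no] :=
  boolP [exists U, closedb (~: edges_at v :\ f) U && odd #|U :\ v|]; first by exists U.
have xz : x != z by apply: contraNneq zn => <-.
have fE := ends_pair xf zf xz.
have fv : f \in ~: edges_at v.
  rewrite in_setC edges_atE fE !inE negb_or eq_sym [v == z]eq_sym zv andbT.
  by case/nbrP: xv.
have cl U : closed_under (~: edges_at v :\: [set f]) U -> ~~ odd #|U :\ v|.
  move/closed_underP => cl; apply: contra no => o.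
  by apply/existsP; exists U; rewrite cl.
have := @bad_count [set f]; rewrite cards1 sub1set => /(_ isT fv cl).
have fx y : y \in nbr v -> (y \in ends f) = (y == x).
  rewrite fE !inE => yv; case: (y =P z) => [yz|]; last by rewrite orbF.
  by case/negP: zn; rewrite -yz inE.
set W := [set x in nbr v | _] => evW; have := bad_odd_nbrs; set W' := [set x in nbr v | _].
have par y : (y \in W) = (y \in W') (+) (y == x).
  rewrite [y \in W]in_set [y \in W']in_set; case yv: (y \in nbr v) => /=.
    by rewrite deg1 fx //; case: (y == x).
  by case: eqP => // yx; rewrite yx xv in yv.
case xW: (x \in W').
  have -> : W' = x |: W.
    by apply/setP => y; rewrite in_setU1 par; case: eqP => [->|]; rewrite ?xW ?addbF.
  by rewrite cardsU1 par xW eqxx /= evW.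
suff WE : W = x |: W' by move: evW; rewrite WE cardsU1 xW /= negbK => ->.
by apply/setP => y; rewrite in_setU1 par; case: eqP => [->|]; rewrite ?xW ?addbF.
Qed.

(** The bouquet is even and not empty. *)
Lemma bad_parallel x y : ~~ odd (d x) -> y \in nbr x -> forall f, f \in edges_at x ->
  y \in ends f -> exists g, [/\ g != f, x \in ends g & y \in ends g].
Proof.
move=> ex /nbrP[yx _] f fx yf.
have evy := even_setP _ (bad_even_edges_at ex) y.
have fs : [set f] \subset edges_at x by rewrite sub1set.
move: evy; rewrite (degB y fs) deg1 yf /= negbK => o.
have /deg_gt0P[g] : 0 < deg (edges_at x :\ f) y by move: o; case: deg.
by rewrite !inE /= => /andP[gf xg] yg; exists g.
Qed.

(** A positive even degree at [t] is impossible by [bad_missing], and an odd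
    degree above one becomes even when color 4 is given to one of the edges of
    [F] at [t]. *)
Lemma missing_deg1 F t : missing_join set0 F -> t \in nbr v -> deg F t <= 1.
Proof.
move=> mj tv; have [pos _] := bad_missing mj; have [_ Fv _ acF par] := mj.
rewrite leqNgt; apply/negP => t1; have ot : odd (deg F t) by apply: pos; rewrite // ltnW.
have /deg_gt0P[g gF tg] : 0 < deg F t by rewrite ltnW.
have gF1 : [set g] \subset F by rewrite sub1set.
have [pos' _] : (forall x, x \in nbr v -> 0 < deg (F :\ g) x -> odd (deg (F :\ g) x)) /\
  ~~ odd #|[set x in nbr v | deg (F :\ g) x == 0]|.
  apply: (@bad_missing [set g]); split.
  - by rewrite cards1.
  - by apply: subset_trans Fv; apply: subsetDl.
  - by rewrite sub1set in_setD in_setD1 eqxx (subsetP Fv).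
  - by apply: acyclicS acF; apply: subsetDl.
  move=> x xv; rewrite -par // deg0 (degB x gF1) oddD addbF addbC.
  by congr (_ (+) _).
have := pos' t tv; move: t1 ot; rewrite (degB t gF1) deg1 tg.
by case: (deg (F :\ g) t) => //= n _ o /(_ isT); rewrite (negPf o).
Qed.
End EvenVertex.

(** Otherwise [bad_bridge] makes [f] a bridge, but [f] has a parallel edge. *)
Lemma even_nbr_closed v x y f : ~~ odd (d v) -> ~~ odd (d x) -> x \in nbr v ->
  x \in ends f -> y \in ends f -> y != v -> y != x -> y \in nbr v.
Proof.
move=> ev ex xv xf yf yv yx; apply/negPn/negP => yn.
have [U [cl oU]] := bad_bridge ev xf yf xv yv yn.
have yx' : y \in nbr x by apply/nbrP; split=> //; exists f.
have fx : f \in edges_at x by rewrite edges_atE.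
have [g [gf xg yg]] := bad_parallel ex yx' fx yf.
have xy : x != y by rewrite eq_sym.
have gE := ends_pair xg yg xy; have fE := ends_pair xf yf xy.
suff /bad_closed : closed_under (~: edges_at v) U by rewrite oU.
move=> e a b ev' ae be; have [ef|ef] := eqVneq e f; last first.
  by apply: (cl e); rewrite // in_setD1 ef.
have ge : ends g = ends e by rewrite gE ef fE.
apply: (cl g); rewrite ?ge // in_setD1 gf in_setC edges_atE ge.
by move: ev'; rewrite in_setC edges_atE.
Qed.

Lemma even_nbr_sub v x : ~~ odd (d v) -> ~~ odd (d x) -> x \in nbr v ->
  forall w, w \in nbr v -> w != x -> w \in nbr x.
Proof.
move=> ev ex xv w /nbrP[wv [e ve we]] wx.
by apply: (even_nbr_closed (x := v) (f := e)) => //; rewrite // nbrC.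
Qed.

(** For adjacent [v] and [x] of even degree, the edge of [F] at [x] leads to
    a third vertex [y] of even degree, and the three vertices have the same
    closed neighborhood. A fourth vertex [t] in it would allow to replace
    the edge [xy] of [F] by the path [xty], which has two edges at [t]. So
    there is none, and [G] is a triangle with even bouquets. *)
Lemma bad_even_nbr v x : ~ shannon_type G 2 2 2 ->
  ~~ odd (d v) -> x \in nbr v -> odd (d x).
Proof.
move=> no222 ev xv; apply/negPn/negP => ex; apply: no222.
have [F mj] : exists F, missing_join v set0 F.
  apply: join_exists; rewrite ?cards0 ?sub0set // setD0; exact: bad_closed.
have [_ Fv _ acF par] := mj; have xnv : x != v by case/nbrP: xv.
have oF z : z != v -> odd (deg F z) = ~~ odd (d z).
  by move=> /par; rewrite deg0 addbF.
have := oF x xnv; rewrite ex => ox.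
have /deg_gt0P[g gF xg] : 0 < deg F x by move: ox; case: deg.
have Fx := missing_deg1 ev mj xv.
have [y yx gE] := other_end xg.
have yg : y \in ends g by rewrite gE !inE eqxx orbT.
have yv : y != v.
  by apply: contraTneq yg => ->; have := subsetP Fv _ gF; rewrite in_setC edges_atE.
have ynb : y \in nbr v by apply: (even_nbr_closed ev ex xv xg).
have Fy := missing_deg1 ev mj ynb.
have Fy1 : deg F y = 1.
  by apply/eqP; rewrite eqn_leq Fy; apply/deg_gt0P; exists g.
have Fx1 : deg F x = 1.
  by apply/eqP; rewrite eqn_leq Fx; apply/deg_gt0P; exists g.
have ey : ~~ odd (d y) by rewrite -oF // Fy1.
have only t : t \in nbr v -> t = x \/ t = y.
  move=> tv; have [->|tx] := eqVneq t x; first by left.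
  have [->|ty] := eqVneq t y; [by right | exfalso].
  have /nbrP[_ [g1 xg1 tg1]] := even_nbr_sub ev ex xv tv tx.
  have /nbrP[_ [g2 yg2 tg2]] := even_nbr_sub ev ey ynb tv ty.
  have tnv : t != v by case/nbrP: tv.
  have g1E : ends g1 = [set x; t] by apply: ends_pair; rewrite // eq_sym.
  have g2E : ends g2 = [set y; t] by apply: ends_pair; rewrite // eq_sym.
  have uniqF h z : h \in F -> z \in ends h -> deg F z = 1 -> z \in ends g -> h = g.
    move=> hF zh Fz zg; have /card_le1_eqP := eq_leq Fz; apply; by rewrite starE ?hF ?gF.
  have tg : t \notin ends g by rewrite gE !inE negb_or tx.
  have g1F : g1 \notin F.
    by apply/negP => /uniqF/(_ xg1 Fx1 xg) E; rewrite -E tg1 in tg.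
  have g2F : g2 \notin F.
    by apply/negP => /uniqF/(_ yg2 Fy1 yg) E; rewrite -E tg2 in tg.
  have g12 : g1 != g2.
    apply/negP => /eqP E; have := yg2; rewrite -E g1E !inE (negPf yx) /=.
    by rewrite eq_sym (negPf ty).
  (* The edge [xy] of [F] is replaced by the path from [x] over [t] to [y]. *)
  pose F' := [set g1; g2] :|: F :\ g.
  have dg : [disjoint [set g1; g2] & F :\ g].
    rewrite disjoints_subset subUset !sub1set !in_setC !in_setD1.
    by rewrite (negPf g1F) (negPf g2F) !andbF.
  have gF1 : [set g] \subset F by rewrite sub1set.
  have deg2 z : deg [set g1; g2] z = (z \in ends g1) + (z \in ends g2).
    by rewrite degU ?deg1 // disjoints1 in_set1.
  have mj' : missing_join v set0 F'.
    split; rewrite ?cards0 ?sub0set //.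
    - rewrite subUset (subset_trans (subsetDl _ _) Fv) andbT subUset !sub1set.
      have ne z : z != v -> (v == z) = false by rewrite eq_sym => /negPf.
      by rewrite !in_setC !edges_atE g1E g2E !in_set2 !ne.
    - move=> F0 F0s F0e; apply: acF (F0e); apply/subsetP => h hF0.
      have := subsetP F0s h hF0; rewrite in_setU => /orP[|]; last first.
        by rewrite in_setD1 => /andP[].
      have key (k : edge G) z : z \in ends k -> z != t -> z \in ends g ->
          deg F z = 1 -> (forall k', k' \in [set g1; g2] -> z \in ends k' -> k' = k) ->
          k \notin F0.
        move=> zk zt zg Fz uk; apply/negP => kF0; have := even_setP _ F0e z.
        suff -> : deg F0 z = 1 by [].
        rewrite -(cards1 k); apply: eq_card => k'; rewrite starE in_set1.
        apply/andP/eqP => [[k'F0 zk']|->//].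
        have := subsetP F0s k' k'F0; rewrite in_setU => /orP[/uk/(_ zk')//|].
        rewrite in_setD1 => /andP[k'g k'F].
        by rewrite (uniqF k' z) ?eqxx in k'g.
      rewrite in_set2 => /orP[]/eqP hE; move: hF0; rewrite hE => hF0; exfalso.
        move: hF0; apply/negP; apply: (key _ x) => //; first by rewrite eq_sym.
        move=> k'; rewrite in_set2 => /orP[/eqP->//|/eqP->].
        by rewrite g2E !inE [x == y]eq_sym (negPf yx) [x == t]eq_sym (negPf tx).
      move: hF0; apply/negP; apply: (key _ y) => //; first by rewrite eq_sym.
      move=> k'; rewrite in_set2 => /orP[|]/eqP-> //.
      by rewrite g1E !inE (negPf yx) [y == t]eq_sym (negPf ty).
    move=> z zv; rewrite deg0 addbF -oF // degU // deg2 (degB z gF1) deg1.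
    rewrite g1E g2E gE !inE !oddD !oddb; congr (_ (+) _).
    have xy : x == y = false by rewrite eq_sym (negPf yx).
    have xt : x == t = false by rewrite eq_sym (negPf tx).
    have yt : y == t = false by rewrite eq_sym (negPf ty).
    have [->|zx] := eqVneq z x; first by rewrite xy xt.
    have [->|zy] := eqVneq z y; first by rewrite yt.
    by rewrite addbb.
  have := missing_deg1 ev mj' tv; rewrite degU // deg2 tg1 tg2.
  by [].
have VE : [set v; x; y] = setT.
  have : closed_under [set: edge G] [set v; x; y].
    have nbs z w f : z \in [set v; x; y] -> z \in ends f -> w \in ends f -> w \in [set v; x; y].
      rewrite !inE -!orbA => zE zf wf.
      have [->|wv] := eqVneq w v; rewrite // orFb.
      have zw (u : vertex G) : u \in nbr v -> ~~ odd (d u) -> z = u -> w \in nbr v \/ w = u.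
        move=> unb eu zu; have [->|wu] := eqVneq w u; [by right|left].
        by apply: (even_nbr_closed ev eu unb (f := f)) => //; rewrite -zu.
      suff /only : w \in nbr v by case=> ->; rewrite eqxx ?orbT.
      case/or3P: zE => /eqP zE.
      - by apply/nbrP; split=> //; exists f => //; rewrite -zE.
      - by have [//|->] := zw _ xv ex zE.
      by have [//|->] := zw _ ynb ey zE.
    by move=> e a b _ ae be; apply/idP/idP => u; [apply: (nbs a b e)|apply: (nbs b a e)].
  by case/conn => // /setP/(_ v); rewrite !inE eqxx.
have vx : v != x by rewrite eq_sym.
have vy : v != y by rewrite eq_sym.
have xy : x != y by rewrite eq_sym.
have adj a b : b \in nbr a -> adjacent a b by rewrite nbr_adjacent => /andP[].
have yx_nb : y \in nbr x by apply: even_nbr_sub ev ex xv _ ynb yx.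
split.
- split; first by rewrite -cardsT -VE -setUA cardsU1 cards2 !inE negb_or vx vy xy.
  move=> a b; have : a \in [set v; x; y] by rewrite VE.
  have : b \in [set v; x; y] by rewrite VE.
  rewrite !inE -!orbA => /or3P[]/eqP-> /or3P[]/eqP->; rewrite ?eqxx // => _;
    by apply: adj; rewrite // nbrC.
- by [].
exists v, x, y; split; first by rewrite /= !inE negb_or vx vy xy.
- by rewrite /parity_code -deg_edges_at_bouquet // (negPf (even_setP _ (bad_even_edges_at ev) x)).
- by rewrite /parity_code -deg_edges_at_bouquet // (negPf (even_setP _ (bad_even_edges_at ex) y)).
by rewrite /parity_code -deg_edges_at_bouquet // (negPf (even_setP _ (bad_even_edges_at ev) y)).
Qed.
End BadGraph.

(** * Cuts and leaves *)

Section Leaves.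
Variable G : mgraph.
Implicit Types (A B F D H Y C : {set edge G}) (U Z X : {set vertex G}).
Implicit Types (x y z p t a b w : vertex G) (e f g h : edge G).

Hypotheses (conn : indecomposable G) (oddV : odd #|vertex G|) (bad : ~ almost3 G).
Local Notation d := (deg [set: edge G]).
Variable v : vertex G.
Hypotheses (ev : ~~ odd (d v)) (nbr_odd : forall x, x \in nbr v -> odd (d x)).

(** [U] is a side of the cut of [G - v] formed by the bouquet of [a] and [b]. *)
Definition cut a b U := [/\ v \notin U, a \notin U, b \in U &
  closed_under (~: edges_at v :\: bouquet a b) U].

Lemma closed_delv D U : D \subset ~: edges_at v -> closed_under D U ->
  closed_under D (U :\ v).
Proof.
move=> Dv cl e x y eD xe ye; rewrite !in_setD1 (cl e x y) //; congr (_ && _).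
have nv z : z \in ends e -> z != v.
  by apply: contraTneq => ->; have := subsetP Dv _ eD; rewrite in_setC edges_atE.
by rewrite !nv.
Qed.

Lemma cut_of_separation a b U : a != v -> b != v ->
  closed_under (~: edges_at v :\: bouquet a b) U -> (a \in U) != (b \in U) ->
  exists U', cut a b U'.
Proof.
move=> av bv; wlog aU : U / a \notin U => [wl cl ab|cl].
  have [aU|aU] := boolP (a \in U); last exact: (wl U).
  apply: (wl (~: U)); first by rewrite in_setC aU.
    exact: closedC.
  by rewrite !in_setC; apply: contra ab => /eqP/negb_inj->.
rewrite (negPf aU); case bU: (b \in U) => // _; exists (U :\ v).
split; rewrite ?in_setD1 ?eqxx ?bU ?bv // ?(negPf aU) ?andbF //.
by apply: closed_delv => //; apply: subsetDl.
Qed.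

(** The odd graph on the vertices other than [v] avoids [h], so [U] is closed in
    it and has an even number of odd vertices. *)
Lemma join_no_bridge Y F h U : missing_join v Y F -> h \in F ->
  closed_under (~: edges_at v :\ h) U -> ~~ odd #|U :\ v|.
Proof.
move=> mj hF cl; have oddH := missing_odd conn oddV bad ev mj.
have Hs : ~: (F :|: edges_at v :|: Y) \subset ~: edges_at v :\ h.
  apply/subsetP => e; rewrite !(in_setC, in_setU, in_setD1) !negb_or.
  case/andP => /andP[eF ->] _; rewrite andbT.
  by apply: contraNneq eF => ->.
have := closed_odd_vertices (closedS Hs cl); congr (~~ odd _).
apply: eq_card => x; rewrite in_set in_setD1 andbC; congr (_ && _).
have [->|/oddH//] := eqVneq x v.
by rewrite deg_off // (subset_trans Hs) ?subsetDl.
Qed.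

(** If the bouquet [B] of [a] and [b] is no cut, there is a [missing_join] whose
    edge of color 4 is in [B] and whose forest [F] avoids [B], the other edges
    of [B] going to color 1. Then [F] has an odd degree at [a]. The other end
    [y] of an edge of [F] at [a] has positive even degree in [F] if it is next
    to [v]; if it is not, the edge is a bridge that [F] cannot contain. *)
Lemma cut_inner a b : a \in nbr v -> b \in nbr v -> b \in nbr a ->
  exists U, cut a b U.
Proof.
move=> an bn ban; have av : a != v by case/nbrP: an.
have bv : b != v by case/nbrP: bn.
have ab : b != a by case/nbrP: ban.
pose B := bouquet a b; pose D0 := ~: edges_at v :\: B.
have [/existsP[U /andP[/closed_underP cl sep]]|no] :=
  boolP [exists U, closedb D0 U && ((a \in U) != (b \in U))].
  exact: cut_of_separation sep.
have nosep U : closed_under D0 U -> (a \in U) = (b \in U).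
  move/closed_underP => cl; apply/eqP/negPn/negP => s.
  by case/existsP: no; exists U; rewrite cl.
have BE e : e \in B -> ends e = [set a; b] by rewrite inE => /eqP.
have Bv : B \subset ~: edges_at v.
  apply/subsetP => e /BE eE; rewrite in_setC edges_atE eE !inE negb_or.
  by rewrite eq_sym av eq_sym bv.
have evU U : closed_under D0 U -> ~~ odd #|U :\ v|.
  move=> cl; apply: (bad_closed conn oddV bad) => e x y eV xe ye.
  case eB: (e \in B); last by apply: (cl e); rewrite // in_setD eB.
  by move: xe ye; rewrite (BE _ eB) !inE => /orP[]/eqP-> /orP[]/eqP->; rewrite // (nosep U).
have degBx x : deg B x = if x \in [set a; b] then #|B| else 0.
  case: ifP => xab.
    by apply: eq_card => e; rewrite starE andbC; case eB: (e \in B); rewrite ?andbF // (BE _ eB) xab.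
  by apply: deg_eq0 => e /BE->; rewrite xab.
(* Color 1 also takes all edges of [B] but one; these affect the parities at [a] and [b] if [#|B|] is even. *)
pose Z := [set x | (x != v) && ((x \in [set a; b]) ==> odd #|B|)].
have [F [Fs acF oddF]] : exists F, [/\ F \subset D0, acyclic F
    & forall x, odd (deg (D0 :\: F) x) = (x \in Z)].
  apply: parity_subgraph => U cl; have evUv := evU U cl.
  case oB: (odd #|B|).
    suff -> : U :&: Z = U :\ v by [].
    by apply/setP => x; rewrite !inE oB implybT andbT andbC.
  have -> : U :&: Z = U :\ v :\: [set a; b].
    apply/setP => x; rewrite in_setI [x \in Z]in_set in_setD in_setD1 oB implybF.
    by case: (x \in U); case: (x != v); case: (x \in [set a; b]).
  move: evUv; rewrite -(cardsID [set a; b] (U :\ v)) oddD.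
  suff -> : odd #|(U :\ v) :&: [set a; b]| = false by [].
  case aU: (a \in U).
    rewrite (setIidPr _) ?cards2 ?[a == b]eq_sym ?ab //.
    by apply/subsetP => x; rewrite !inE => /orP[]/eqP->; rewrite ?av ?bv -?(nosep U).
  rewrite (_ : _ :&: _ = set0) ?cards0 //; apply/setP => x; rewrite !inE.
  by apply/negP => /andP[/andP[_ xU] /orP[]/eqP xE]; rewrite xE -?(nosep U cl) aU in xU.
have /card_gt0P[f fB] : 0 < #|B| by move: ban; rewrite inE ab deg_edges_at_bouquet // eq_sym.
move: Fs; rewrite subsetD => /andP[Fv dFB].
have mj : missing_join v [set f] F.
  split=> //; first by rewrite cards1.
    by rewrite sub1set in_setD (subsetP Bv _ fB) andbT (disjointFl dFB).
  move=> x xv; rewrite deg1 (BE _ fB).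
  have : odd (d x) = odd (deg B x) (+) odd (deg F x) (+) (x \in Z).
    have FD0 : F \subset D0 by rewrite subsetD Fv.
    have E : d x = deg (edges_at v) x + (deg B x + (deg F x + deg (D0 :\: F) x)).
      by rewrite (degB x (subsetT (edges_at v))) setTD (degB x Bv) -/D0 (degB x FD0).
    by rewrite E !oddD (negPf (even_setP _ (bad_even_edges_at conn oddV bad ev) x)) oddF /= addbA.
  move=> ->; rewrite degBx [x \in Z]in_set xv; case: ifP => _ /=.
    by case: odd; case: odd.
  by case: odd.
have [pos _] := bad_missing conn oddV bad ev mj; have [_ _ _ _ par] := mj.
have := par a av; rewrite deg1 (BE _ fB) set21 (nbr_odd an) addbT => /negbFE oa.
have /deg_gt0P[h hF ah] : 0 < deg F a by move: oa; case: deg.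
have [y ya hE] := other_end ah.
have yh : y \in ends h by rewrite hE set22.
have yv : y != v.
  by apply: contraTneq yh => ->; have := subsetP Fv _ hF; rewrite in_setC edges_atE.
have yb : y != b.
  by apply/eqP => yb; have := disjointFr dFB hF; rewrite inE hE yb eqxx.
exfalso; have [yn|yn] := boolP (y \in nbr v).
  have := par y yv; rewrite deg1 (BE _ fB) in_set2 (negPf ya) (negPf yb) addbF (nbr_odd yn).
  by rewrite pos //; apply/deg_gt0P; exists h.
have [U [cl oU]] := bad_bridge conn oddV bad ev ah yh an yv yn.
by have := join_no_bridge mj hF cl; rewrite oU.
Qed.

Lemma cut_exists a b : a \in nbr v -> b \in nbr a -> b != v -> exists U, cut a b U.
Proof.
move=> an ban bv; have [bn|bn] := boolP (b \in nbr v); first exact: cut_inner.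
have av : a != v by case/nbrP: an.
have /nbrP[ba [f af bf]] := ban; have ab : a != b by rewrite eq_sym.
have [U [cl oU]] := bad_bridge conn oddV bad ev af bf an bv bn.
apply: (@cut_of_separation a b U) => //.
  apply: closedS cl; apply: setDS; rewrite sub1set inE; apply/eqP.
  exact: ends_pair.
apply/eqP => abU; suff : closed_under (~: edges_at v) U.
  by move/(bad_closed conn oddV bad); rewrite oU.
move=> e x y eV xe ye; have [ef|ef] := eqVneq e f; last first.
  by apply: (cl e); rewrite // in_setD1 ef.
move: xe ye; rewrite ef (ends_pair af bf ab) !inE.
by move=> /orP[]/eqP-> /orP[]/eqP->.
Qed.

(** Otherwise [U] is attached to the rest of [G] at [a] only. The bridge [f]
    from [a] to [U] given by [bad_bridge] has an odd side [W], and [W :&: U] is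
    a union of components of [G - a], while [W :\: U] is one of [G - v]. Both
    are even. *)
Lemma side_meets_nbr a U : a \in nbr v -> v \notin U -> a \notin U -> U != set0 ->
  closed_under (~: (edges_at v :|: edges_at a)) U -> exists2 w, w \in U & w \in nbr v.
Proof.
move=> an vU aU U0 clU.
have [/existsP[w /andP[wU wn]]|no] := boolP [exists w, (w \in U) && (w \in nbr v)].
  by exists w.
exfalso; have nonb w : w \in nbr v -> w \notin U.
  by move=> wn; apply: contra no => wU; apply/existsP; exists w; rewrite wU.
have offv e x : v \in ends e -> x \in ends e -> x \notin U.
  by move=> ve xe; have [->//|xv] := eqVneq x v; apply: nonb; apply/nbrP; split=> //; exists e.
have clUa : closed_under (~: edges_at a) U.
  move=> e x y ea xe ye; case ve: (v \in ends e).
    by rewrite (negPf (offv e x _ _)) // (negPf (offv e y _ _)).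
  by apply: (clU e) => //; move: ea; rewrite !(in_setC, in_setU) !edges_atE ve.
have [f [z [af zf zU]]] : exists f z, [/\ a \in ends f, z \in ends f & z \in U].
  have [/existsP[f /andP[af /existsP[z /andP[zf zU]]]]|nof] :=
    boolP [exists f, (a \in ends f) && [exists z, (z \in ends f) && (z \in U)]].
    by exists f, z.
  suff /conn[U0'|UT] : closed_under setT U.
  - by rewrite U0' eqxx in U0.
  - by rewrite UT inE in vU.
  move=> e x y _ xe ye; case ae: (a \in ends e); last first.
    by apply: (clUa e); rewrite // in_setC edges_atE ae.
  have out z : z \in ends e -> z \in U = false.
    move=> ze; apply: contraNF nof => zU; apply/existsP; exists e; rewrite ae.
    by apply/existsP; exists z; rewrite ze.
  by rewrite !out.
have zv : z != v by apply: contraTneq zU => ->.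
have zn : z \notin nbr v by apply: contraL zU => /nonb.
have za : a != z by apply: contraTneq zU => <-.
have fE := ends_pair af zf za.
have [U' [cl' oU']] := bad_bridge conn oddV bad ev af zf an zv zn.
(* Otherwise [f] does not leave [U'], which is then even. *)
have sep : (a \in U') != (z \in U').
  apply/eqP => azU; suff : closed_under (~: edges_at v) U'.
    by move/(bad_closed conn oddV bad); rewrite oU'.
  move=> e x y eV xe ye; have [ef|ef] := eqVneq e f; last first.
    by apply: (cl' e); rewrite // in_setD1 ef.
  by move: xe ye; rewrite ef fE !inE => /orP[]/eqP-> /orP[]/eqP->.
have [W [clW oW zW aW]] : exists W, [/\ closed_under (~: edges_at v :\ f) W,
    odd #|W :\ v|, z \in W & a \notin W].
  case zU': (z \in U').
    by exists U'; split=> //; move: sep; rewrite zU'; case: (a \in U').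
  exists (~: U'); split; rewrite ?in_setC ?zU' //.
  - exact: closedC.
  - have := cardsC1 v; rewrite -(cardsID U' [set~ v]).
    have -> : [set~ v] :&: U' = U' :\ v by rewrite setIC setDE.
    have -> : [set~ v] :\: U' = ~: U' :\ v by rewrite !setDE setIC.
    move/(congr1 odd); rewrite oddD oU' addTb => E; rewrite -[odd _]negbK E.
    have V0 : 0 < #|vertex G| by case: #|_| oddV.
    by move: oddV; rewrite -{1}(prednK V0).
  by move: sep; rewrite zU'; case: (a \in U').
have e1 : ~~ odd #|W :&: U|.
  have -> : W :&: U = (W :&: U) :\ a.
    apply/setP => x; rewrite in_setD1; case: eqP => // ->.
    by rewrite inE (negPf aU) andbF.
  apply: (bad_closed conn oddV bad) => e x y ea xe ye; rewrite !in_setI.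
  case ve: (v \in ends e).
    by rewrite (negPf (offv e x _ _)) // (negPf (offv e y _ _)) // !andbF.
  rewrite (clUa e x y) //; congr (_ && _); apply: (clW e) => //.
  rewrite in_setD1 in_setC edges_atE ve andbT.
  by apply: contraTneq ea => ->; rewrite in_setC edges_atE af.
have e2 : ~~ odd #|W :\: U :\ v|.
  apply: (bad_closed conn oddV bad) => e x y eV xe ye; rewrite !in_setD.
  have [ef|ef] := eqVneq e f.
    have out t : t \in ends f -> (t \notin U) && (t \in W) = false.
      by rewrite fE !inE => /orP[]/eqP->; rewrite ?zU ?(negPf aW) ?andbF.
    by rewrite !out -?ef.
  have Wxy : (x \in W) = (y \in W) by apply: (clW e); rewrite // in_setD1 ef.
  case ae: (a \in ends e).
    have Wax : (a \in W) = (x \in W) by apply: (clW e); rewrite // in_setD1 ef.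
    by rewrite -Wxy -Wax (negPf aW) !andbF.
  by rewrite Wxy (clUa e x y) // in_setC edges_atE ae.
have := oW; rewrite -(cardsID U (W :\ v)).
have -> : (W :\ v) :&: U = W :&: U.
  apply/setP => x; rewrite !in_setI in_setD1; have [->|//] := eqVneq x v.
  by rewrite (negPf vU) !andbF.
have -> : (W :\ v) :\: U = W :\: U :\ v by rewrite !setDDl setUC.
by rewrite oddD (negPf e1) (negPf e2).
Qed.

Definition leaf w b := [/\ w \in nbr v, b \in nbr w, b != v &
  forall y, y \in nbr w -> y = v \/ y = b].

Lemma nbr_other w : w \in nbr v -> exists2 y, y \in nbr w & y != v.
Proof.
move=> wn; have [/existsP[y /andP[]]|no] := boolP [exists y, (y \in nbr w) && (y != v)].
  by exists y.
have := nbr_odd wn; suff -> : d w = deg (edges_at v) w.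
  by rewrite (negPf (even_setP _ (bad_even_edges_at conn oddV bad ev) w)).
apply: eq_card => e; rewrite !starE !in_setT /=; case we: (w \in ends e); rewrite ?andbF //.
have [y yw eE] := other_end we; rewrite eE in_set2 andbT.
have [//|yv] := eqVneq v y; first by rewrite orbT.
case/existsP: no; exists y; rewrite eq_sym yv andbT; apply/nbrP; split=> //.
by exists e; rewrite ?we // eE set22.
Qed.

Lemma cut_edge a b U e x y : cut a b U -> e \notin bouquet a b ->
  x \in ends e -> y \in ends e -> x != v -> y != v -> x != y -> (x \in U) = (y \in U).
Proof.
move=> [_ _ _ cl] eB xe ye xv yv xy; apply: (cl e) => //.
rewrite in_setD eB in_setC edges_atE (ends_pair xe ye xy) in_set2 negb_or.
by rewrite eq_sym xv eq_sym yv.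
Qed.

(** A cut at a vertex [w] inside of [U] that does not separate [w] from [a] has
    a side inside of [U]. *)
Lemma cutI a b U w y U' : cut a b U -> cut w y U' -> a \notin U' -> w \in U ->
  w != v -> y != v -> y \in nbr w -> cut w y (U :&: U').
Proof.
move=> cU cU' aU' wU wv yv /nbrP[yw [e0 we0 ye0]].
have [vU aU bU cl] := cU; have [vU' wU' yU' cl'] := cU'.
have yU : y \in U.
  rewrite -(cut_edge cU _ we0 ye0) // 1?eq_sym //.
  have wy : w != y by rewrite eq_sym.
  rewrite inE (ends_pair we0 ye0 wy); apply/eqP => E.
  have := set21 a b; rewrite -E in_set2 => /orP[]/eqP aE; first by rewrite aE wU in aU.
  by rewrite aE yU' in aU'.
split; rewrite ?in_setI ?(negPf vU) ?(negPf wU') ?andbF ?yU ?yU' //.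
move=> e p q; rewrite in_setD => /andP[eB eV] pe qe; rewrite !in_setI.
have pq' r s : r \in ends e -> s \in ends e -> (r \in U') = (s \in U').
  by move=> re se; apply: (cl' e); rewrite // in_setD eB.
case eab: (e \in bouquet a b).
  have ae : a \in ends e by move: eab; rewrite inE => /eqP->; rewrite set21.
  by rewrite -(pq' a p) // -(pq' a q) // (negPf aU') !andbF.
by rewrite (pq' p q) // (cl e p q) // in_setD eab.
Qed.

(** The sides of two cuts at [w] are made disjoint by removing one from the
    other. *)
Lemma cutD w y1 y2 U1 U2 : cut w y1 U1 -> cut w y2 U2 -> w != v ->
  y1 \in nbr w -> y2 \in nbr w -> y1 != v -> y2 != v -> y1 != y2 -> cut w y1 (U1 :\: U2).
Proof.
move=> c1 c2 wv /nbrP[y1w [e1 we1 ye1]] /nbrP[y2w [e2 we2 ye2]] y1v y2v y12.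
have [vU1 wU1 yU1 cl1] := c1; have [vU2 wU2 yU2 cl2] := c2.
have neq y y' (e : edge G) : y != w -> y != y' -> w \in ends e -> y \in ends e -> e \notin bouquet w y'.
  move=> yw yy' we ye; have wy : w != y by rewrite eq_sym.
  rewrite inE (ends_pair we ye wy); apply/eqP/setP => /(_ y).
  by rewrite !inE eqxx orbT (negPf yw) (negPf yy').
have y1U2 : y1 \notin U2.
  by rewrite -(cut_edge c2 (neq _ _ _ y1w y12 we1 ye1) we1 ye1) // eq_sym.
have y2U1 : y2 \notin U1.
  have y21 : y2 != y1 by rewrite eq_sym.
  by rewrite -(cut_edge c1 (neq _ _ _ y2w y21 we2 ye2) we2 ye2) // eq_sym.
split; rewrite ?in_setD ?(negPf vU1) ?(negPf wU1) ?andbF ?y1U2 //.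
move=> e p q; rewrite in_setD => /andP[eB eV] pe qe; rewrite !in_setD.
have pq : (p \in U1) = (q \in U1) by apply: (cl1 e); rewrite // in_setD eB.
case e2B: (e \in bouquet w y2); last first.
  by rewrite pq (cl2 e p q) // in_setD e2B.
have out r : r \in ends e -> r \in U1 = false.
  move: e2B; rewrite inE => /eqP->; rewrite in_set2 => /orP[]/eqP->.
    exact: negPf.
  exact: negPf.
by rewrite !out // !andbF.
Qed.

(** By induction on the size of the side [U]. It contains a neighbor [w] of [v].
    If [w] has two further neighbors, the two cuts at [w] yield a side that
    does not contain [a], hence a smaller side inside of [U]. *)
Lemma leaf_in_cut a b U : a \in nbr v -> cut a b U ->
  exists w b', w \in U /\ leaf w b'.
Proof.
have [n] := ubnP #|U|; elim: n => // n IHn in a b U *; rewrite ltnS => Un an cU.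
have [vU aU bU cl] := cU.
have [w wU wn] : exists2 w, w \in U & w \in nbr v.
  apply: (side_meets_nbr an) => //; first by apply/set0Pn; exists b.
  apply: closedS cl; apply/subsetP => e.
  rewrite in_setC in_setU negb_or in_setD in_setC => /andP[-> ea]; rewrite andbT.
  by apply: contra ea; rewrite inE edges_atE => /eqP->; rewrite set21.
have wv : w != v by case/nbrP: wn.
have rec y U' : y \in nbr w -> y != v -> cut w y U' -> a \notin U' ->
    exists w b', w \in U /\ leaf w b'.
  move=> yn yv cU' aU'; have cI := cutI cU cU' aU' wU wv yv yn.
  have [|w' [b' [w'U lf]]] := IHn w y _ _ wn cI; last first.
    by exists w', b'; split=> //; move: w'U; rewrite inE => /andP[].
  apply: leq_trans Un; apply: proper_card; rewrite properE subsetIl /=.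
  apply/subsetPn; exists w => //; rewrite inE wU /=; by have [] := cU'.
have [y1 y1n y1v] := nbr_other wn.
have [/forall_inP all1|] := boolP [forall y in nbr w, (y == v) || (y == y1)].
  by exists w, y1; split=> //; split=> // y /all1/orP[]/eqP->; [left|right].
case/forall_inPn => y2 y2n; rewrite negb_or => /andP[y2v y21].
have [U1 c1] := cut_exists wn y1n y1v; have [U2 c2] := cut_exists wn y2n y2v.
(* At least one of [U1], [U2] and [U1 :\: U2] does not contain [a]. *)
have [aU1|aU1] := boolP (a \in U1); last exact: (rec y1 U1).
have [aU2|aU2] := boolP (a \in U2); last exact: (rec y2 U2).
apply: (rec y1 (U1 :\: U2)) => //; last by rewrite in_setD aU2.
by apply: (cutD c1 c2); rewrite // eq_sym.
Qed.

End Leaves.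

(** * Pairs of leaves in one component *)

Section LeafPairs.
Variable G : mgraph.
Implicit Types (A B F D H Y C Q : {set edge G}) (U Z X W : {set vertex G}).
Implicit Types (x y z p t a b w : vertex G) (e f g h : edge G).

Hypotheses (conn : indecomposable G) (oddV : odd #|vertex G|) (bad : ~ almost3 G).
Local Notation d := (deg [set: edge G]).
Variable v : vertex G.
Hypotheses (ev : ~~ odd (d v)) (nbr_odd : forall x, x \in nbr v -> odd (d x)).

(** All edges at a leaf [a] go to [v] or [b]; the bouquet with [v] is even, so
    the bouquet with [b] is odd. *)
Lemma leafP a b : leaf v a b ->
  [/\ a != v, b != v, b != a &
   [/\ forall e, a \in ends e -> v \in ends e \/ b \in ends e,
       forall x, odd (deg (edges_at a) x) = (x \in [set a; b]),
       0 < deg (edges_at a) v & even_set (edges_at a :&: edges_at v)]].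
Proof.
case=> an ban bv nba; have av : a != v by case/nbrP: an.
have ba : b != a by case/nbrP: ban.
have only e : a \in ends e -> v \in ends e \/ b \in ends e.
  move=> ae; have [y ya eE] := other_end ae; have ye : y \in ends e by rewrite eE set22.
  have /nba[<-|<-] : y \in nbr a by apply/nbrP; split=> //; exists e.
  - by left.
  by right.
have degav : deg (edges_at a) v = deg (edges_at v) a.
  by apply: eq_card => e; rewrite !starE !in_setT andbC.
have evav : ~~ odd (deg (edges_at a) v).
  by rewrite degav (even_setP _ (bad_even_edges_at conn oddV bad ev)).
have odda : odd (deg (edges_at a) a) by rewrite deg_edges_at nbr_odd.
have zero x : x != a -> x != b -> x != v -> deg (edges_at a) x = 0.
  move=> xa xb xv; apply: deg_eq0 => e; rewrite edges_atE => ae; apply/negP => xe.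
  have ax : a != x by rewrite eq_sym.
  have := only e ae; rewrite (ends_pair ae xe ax) !in_set2.
  rewrite eq_sym (negPf av) eq_sym (negPf xv) (negPf ba) eq_sym (negPf xb).
  by case.
have par x : odd (deg (edges_at a) x) = (x \in [set a; b]).
  rewrite in_set2; have [->|xa] := eqVneq x a; first by rewrite odda.
  have [->|xb] := eqVneq x b; last first.
    by have [->|xv] := eqVneq x v; rewrite ?(negPf evav) // zero.
  apply/negPn/negP => ob.
  have clT : closed_under (edges_at a) setT by move=> e y z; rewrite !in_setT.
  have := closed_odd_vertices clT.
  have -> : [set x in setT | odd (deg (edges_at a) x)] = [set a].
    apply/setP => y; rewrite in_set in_setT in_set1 /=.
    have [->|ya] := eqVneq y a; first by rewrite odda.
    have [->|yb] := eqVneq y b; first exact: negPf.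
    by have [->|yv] := eqVneq y v; rewrite ?(negPf evav) // zero.
  by rewrite cards1.
split=> //; split=> //.
  by rewrite degav; move: an; rewrite inE => /andP[].
apply/even_setP => x; have [->|xa] := eqVneq x a.
  suff -> : deg (edges_at a :&: edges_at v) a = deg (edges_at a) v by [].
  by apply: eq_card => e; rewrite !inE; do 2?case: (_ \in ends e).
have [->|xv] := eqVneq x v.
  suff -> : deg (edges_at a :&: edges_at v) v = deg (edges_at a) v by [].
  by apply: eq_card => e; rewrite !inE; do 2?case: (_ \in ends e).
rewrite deg_eq0 // => e; rewrite in_setI !edges_atE => /andP[ae ve].
by rewrite (ends_pair ae ve av) in_set2 negb_or xa.
Qed.

Lemma leaves_apart a b a' b' : leaf v a b -> leaf v a' b' -> a != a' -> b != a' ->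
  forall e, a \in ends e -> a' \notin ends e.
Proof.
move=> /leafP[av bv ba [only _ _ _]] /leafP[a'v _ _ _] aa' ba' e ae; apply/negP => ae'.
have := only e ae; rewrite (ends_pair ae ae' aa') !in_set2.
by rewrite eq_sym (negPf av) eq_sym (negPf a'v) (negPf ba) (negPf ba'); case.
Qed.

(** An edge [f] from [a] to [b] gets color 4 and color 1 omits [a']. Removing
    [v] and the two leaves leaves even components only, because [a] and [a']
    are in the same component of [G - v]; let [F] be a forest there. Colors 2
    and 3 share [F], the edges at [a'] and one edge [g] between [v] and [a].
    These are an odd number of edges at [v] and at [a'], and as [a] has degree
    one in them, a split cycle consists of edges at [a'] and touches no
    vertex. *)
Lemma leaf_same_side a b a' b' :
  leaf v a b -> leaf v a' b' -> a != a' -> b != a' ->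
  (forall U, closed_under (~: edges_at v) U -> (a \in U) = (a' \in U)) -> False.
Proof.
move=> la la' aa' ba' nosep; have apart := leaves_apart la la' aa' ba'.
have [av bv ba [only par va_pos evav]] := leafP la.
have [a'v b'v ba'' [only' par' va'_pos evav']] := leafP la'.
have b'a : b' != a.
  apply/eqP => E; have [_ /nbrP[_ [e ae' be']] _ _] := la'.
  by have := apart e; rewrite -E be' ae' => /(_ isT).
have apart' e : a' \in ends e -> a \notin ends e.
  by move=> ae'; apply: contraL ae' => /apart.
pose D0 := ~: (edges_at v :|: edges_at a :|: edges_at a').
pose Z := ~: [set v; a; a'].
have [F [Fs acF oddF]] : exists F, [/\ F \subset D0, acyclic F
    & forall x, odd (deg (D0 :\: F) x) = (x \in Z)].
  apply: parity_subgraph => U cl.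
  (* Each leaf is put on the side of its further neighbor. *)
  pose W := [set x | if x == a then b \in U else if x == a' then b' \in U else x \in U].
  have aW : (a \in W) = (b \in U) by rewrite inE eqxx.
  have a'W : (a' \in W) = (b' \in U) by rewrite inE eqxx eq_sym (negPf aa').
  have xW x : x != a -> x != a' -> (x \in W) = (x \in U).
    by move=> xa xa'; rewrite inE (negPf xa) (negPf xa').
  have bW : (b \in W) = (b \in U) by rewrite xW.
  have b'W : (b' \in W) = (b' \in U) by rewrite xW.
  have clW : closed_under (~: edges_at v) W.
    move=> e x y; rewrite in_setC edges_atE => nve xe ye.
    case ae: (a \in ends e).
      have [vE|be] := only e ae; first by rewrite vE in nve.
      have eE := ends_pair ae be; rewrite eq_sym in eE.
      by move: xe ye; rewrite (eE ba) !in_set2 => /orP[]/eqP-> /orP[]/eqP->; rewrite ?aW ?bW.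
    case ae': (a' \in ends e).
      have [vE|be] := only' e ae'; first by rewrite vE in nve.
      have eE := ends_pair ae' be; rewrite eq_sym in eE.
      by move: xe ye; rewrite (eE ba'') !in_set2 => /orP[]/eqP-> /orP[]/eqP->; rewrite ?a'W ?b'W.
    have ne z : z \in ends e -> z != a /\ z != a'.
      by move=> ze; split; apply: contraTneq ze => ->; rewrite ?ae ?ae'.
    have [xa xa'] := ne x xe; have [ya ya'] := ne y ye.
    by rewrite !xW // (cl e x y) // in_setC !in_setU !edges_atE (negPf nve) ae ae'.
  have bb' : (b \in U) = (b' \in U) by rewrite -aW -a'W nosep.
  have := bad_closed conn oddV bad clW; rewrite -(cardsID [set a; a'] (W :\ v)) oddD.
  have -> : odd #|(W :\ v) :&: [set a; a']| = false.
    case bU: (b \in U).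
      rewrite (setIidPr _) ?cards2 ?aa' //; apply/subsetP => x; rewrite in_set2 in_setD1.
      by case/orP=> /eqP->; rewrite ?av ?a'v ?aW ?a'W -?bb' bU.
    rewrite (_ : _ :&: _ = set0) ?cards0 //; apply/setP => x; rewrite in_setI in_setD1 in_set2 in_set0.
    by apply/negP => /andP[/andP[_ xW'] /orP[]/eqP xE]; move: xW'; rewrite xE ?aW ?a'W -?bb' bU.
  rewrite addFb; congr (~~ odd #|pred_of_set _|); apply/setP => x.
  rewrite in_setD in_setD1 in_setI in_setC !in_setU !in_set1 !negb_or.
  have [->|xa] := eqVneq x a; first by rewrite !andbF.
  have [->|xa'] := eqVneq x a'; first by rewrite !andbF.
  by rewrite xW //; case: (x != v); case: (x \in U).
have /deg_gt0P[g ga vg] := va_pos; rewrite edges_atE in ga.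
have [_ /nbrP[_ [f af bf]] _ _] := la.
have ab : a != b by rewrite eq_sym.
have fE := ends_pair af bf ab; have gE := ends_pair ga vg av.
have nF e : e \in F -> [/\ v \notin ends e, a \notin ends e & a' \notin ends e].
  by move/(subsetP Fs); rewrite in_setC !in_setU !edges_atE !negb_or => /andP[/andP[-> ->] ->].
have fg : f != g.
  apply/eqP => E; have := vg; rewrite -E fE in_set2 eq_sym (negPf av).
  by rewrite eq_sym (negPf bv).
pose D := F :|: [set g] :|: edges_at a'.
have dD : [disjoint F :|: [set g] & edges_at a'].
  rewrite disjoints_subset subUset sub1set in_setC edges_atE apart // andbT.
  by apply/subsetP => e /nF[_ _]; rewrite in_setC edges_atE.
have dFg : [disjoint F & [set g]].
  rewrite disjoint_sym disjoints1; apply/negP => /nF[]; rewrite vg //.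
have degD x : deg D x = deg F x + (x \in ends g) + deg (edges_at a') x.
  by rewrite degU // degU // deg1.
have dYD : [disjoint [set f] & D].
  rewrite disjoints1 !in_setU in_set1 (negPf fg) edges_atE (negPf (apart f af)) !orbF.
  by apply/negP => /nF[]; rewrite af.
have oddinc (c c' : vertex G) x : (forall x, odd (deg (edges_at c) x) = (x \in [set c; c'])) ->
    even_set (edges_at c :&: edges_at v) -> odd (deg (edges_at c :\: edges_at v) x) = (x \in [set c; c']).
  by move=> <- evc; rewrite (degID (edges_at v) (edges_at c)) oddD (negPf (even_setP _ evc x)).
have oddd x : odd (d x) = (x \in [set a; b]) (+) (x \in [set a'; b']) (+) odd (deg F x) (+) (x \in Z).
  have E : d x = deg (edges_at v) x + (deg (edges_at a :\: edges_at v) x +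
      (deg (edges_at a' :\: edges_at v) x + (deg F x + deg (D0 :\: F) x))).
    rewrite (degB x (subsetT (edges_at v))); congr (_ + _); rewrite setTD.
    have s1 : edges_at a :\: edges_at v \subset ~: edges_at v by rewrite setDE subsetIr.
    rewrite (degB x s1); congr (_ + _).
    have s2 : edges_at a' :\: edges_at v \subset ~: edges_at v :\: (edges_at a :\: edges_at v).
      apply/subsetP => e; rewrite !in_setD in_setC => /andP[-> ea']; rewrite andbT /=.
      by move: ea'; rewrite !edges_atE => /apart'.
    rewrite (degB x s2); congr (_ + _); rewrite -(degB x Fs); congr deg.
    apply/setP => e; rewrite !in_setD !in_setC !in_setU.
    by case: (e \in edges_at v); case: (e \in edges_at a); case: (e \in edges_at a').
  rewrite E !oddD (oddinc _ _ _ par evav) (oddinc _ _ _ par' evav') oddF.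
  by rewrite (negPf (even_setP _ (bad_even_edges_at conn oddV bad ev) x)) /= !addbA.
have oddH x : odd (deg (~: (D :|: [set f])) x) = (x != a').
  have := oddd x; rewrite (degB x (subsetT (D :|: [set f]))) setTD oddD.
  rewrite degU 1?disjoint_sym // degD deg1 !oddD !oddb par' fE gE.
  rewrite in_setC !in_setU !in_set1.
  have F_ p q : p != q -> ((p == q) = false) * ((q == p) = false).
    by move=> /negPf pq; rewrite [q == p]eq_sym pq.
  pose neE := (F_ _ _ aa', F_ _ _ av, F_ _ _ bv, F_ _ _ ba, F_ _ _ a'v, F_ _ _ b'v,
    F_ _ _ ba'', F_ _ _ ba', F_ _ _ b'a).
  have [->|xa'] := eqVneq x a'.
    by rewrite !neE ?eqxx /=; case: (odd _); case: (odd _).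
  have [->|xa] := eqVneq x a.
    by rewrite !neE ?eqxx /=; case: (odd (deg F a)); case: (odd _).
  rewrite ?orbF /=; have [->|xv] := eqVneq x v.
    by rewrite !neE ?eqxx /=; case: (odd (deg F v)); case: (odd _).
  by case: (x == b); case: (x == b'); case: (odd (deg F x)) => /=; case: (odd _).
apply: bad; apply: (almost3_decomposition (D := D) (Y := [set f])) => //.
- by rewrite cards1.
- apply/forallP => x; rewrite oddH; have [->|] := eqVneq x a'; last by rewrite orbT.
  rewrite deg_eq0 // => e; rewrite in_setC !in_setU !negb_or => /andP[/andP[_]].
  by rewrite edges_atE.
- move=> F0 /and3P[F0s F0e /forall_inP allF0].
  have F0a : g \notin F0.
    apply/negP => gF0; have := even_setP _ F0e a.
    suff -> : deg F0 a = 1 by [].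
    apply/eqP; rewrite eqn_leq; apply/andP; split; last by apply/deg_gt0P; exists g.
    apply: leq_trans (leq_deg a F0s) _; rewrite degD ga.
    rewrite !deg_eq0 // => e; first by rewrite edges_atE => /apart'.
    by case/nF.
  have F0D e : e \in F0 -> e \in F \/ a' \in ends e.
    move=> eF0; have := subsetP F0s e eF0; rewrite !in_setU in_set1 edges_atE.
    case: eqP => [eg|_]; first by rewrite -eg eF0 in F0a.
    by rewrite orbF => /orP[]; [left|right].
  pose B := F0 :&: edges_at a'.
  have BF0 : B \subset F0 by apply: subsetIl.
  have F0B : F0 :\: B \subset F.
    apply/subsetP => e; rewrite in_setD in_setI edges_atE negb_and => /andP[nB eF0].
    by have [//|ae'] := F0D e eF0; rewrite eF0 ae' in nB.
  have evB : even_set B.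
    apply: (even_set_except (v := b')) => x xb'.
    have := even_setP _ F0e x; rewrite (degB x BF0).
    have [->|xa'] := eqVneq x a'.
      rewrite [deg (F0 :\: B) a']deg_eq0 ?addn0 // => e.
      by rewrite in_setD in_setI edges_atE negb_and => /andP[/orP[/negPf->|]].
    have [->|xv] := eqVneq x v.
      by rewrite [deg (F0 :\: B) v]deg_eq0 ?addn0 // => e /(subsetP F0B)/nF[].
    rewrite [deg B x]deg_eq0 // => e; rewrite in_setI edges_atE => /andP[_ ae'].
    apply/negP => xe; have := only' e ae'; have a'x : a' != x by rewrite eq_sym.
    rewrite (ends_pair ae' xe a'x) !in_set2 eq_sym (negPf a'v) eq_sym (negPf xv).
    by rewrite (negPf ba'') eq_sym (negPf xb'); case.
  have F0E : F0 = B.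
    apply/eqP; rewrite eqEsubset BF0 andbT -setD_eq0; apply/eqP/acF => //.
    exact: even_setD.
  rewrite (_ : touched D F0 = set0) ?cards0 //; apply/setP => p.
  rewrite in_set in_set0; apply/negP => /andP[pP /deg_gt0P[e eF0 pe]].
  have ae' : a' \in ends e by move: eF0; rewrite F0E in_setI edges_atE => /andP[].
  have pO : ~~ odd (deg D p) by move: pP; rewrite inE => /andP[].
  have [pa'|pa'] := eqVneq p a'.
    move: pO; rewrite pa' degD [deg F a']deg_eq0 ?(negPf (apart g ga)) ?par' ?set21 //.
    by move=> h /nF[].
  have [pv|pv] := eqVneq p v.
    move: pO; rewrite pv degD [deg F v]deg_eq0 ?vg; last by move=> h /nF[].
    by rewrite oddD par' in_set2 eq_sym (negPf a'v) eq_sym (negPf b'v).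
  have a'p : a' != p by rewrite eq_sym.
  have pb' : p = b'.
    have := only' e ae'; rewrite (ends_pair ae' pe a'p) !in_set2 eq_sym (negPf a'v).
    by rewrite eq_sym (negPf pv) (negPf ba'') => -[//|/eqP].
  have /orP[sub|] := allF0 p pP; last first.
    rewrite disjoints_subset => /subsetP/(_ e).
    by rewrite starE (subsetP F0s) // pe in_setC eF0 => /(_ isT).
  have := even_setP _ F0e p; suff -> : deg F0 p = deg (edges_at a') p.
    by rewrite par' pb' set22.
  apply: eq_card => h; rewrite !starE in_setT /=.
  case ph: (p \in ends h); rewrite ?andbF ?andbT //.
  apply/idP/idP => [|a'h]; first by rewrite F0E in_setI edges_atE => /andP[].
  by apply: (subsetP sub); rewrite starE ph !in_setU edges_atE a'h orbT.
move=> e /set1P->; left => x; rewrite fE in_set2 => xab.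
have : x != a' by case/orP: xab => /eqP->.
by rewrite -oddH; case: deg.
Qed.

End LeafPairs.

(** * Leaves in different components *)

Section Separated.
Variable G : mgraph.
Implicit Types (A B F D H Y C Q : {set edge G}) (U Z X W S : {set vertex G}).
Implicit Types (x y z p t a b w : vertex G) (e f g h : edge G).

Hypotheses (conn : indecomposable G) (oddV : odd #|vertex G|) (bad : ~ almost3 G).
Local Notation d := (deg [set: edge G]).
Variable v : vertex G.
Hypotheses (ev : ~~ odd (d v)) (nbr_odd : forall x, x \in nbr v -> odd (d x)).

Lemma leaf_end_side a b S : leaf v a b -> closed_under (~: edges_at v) S -> (a \in S) = (b \in S).
Proof.
move=> la clS; have [av bv ba _] := leafP conn oddV bad ev nbr_odd la.
have [_ /nbrP[_ [f af bf]] _ _] := la; apply: (clS f) => //.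
have ab : a != b by rewrite eq_sym.
by rewrite in_setC edges_atE (ends_pair af bf ab) in_set2 !negb_or eq_sym av eq_sym bv.
Qed.

(** A part of [G - a - a'] on the side [S] of [a] is attached to the rest at [v]
    or [a] only, and by [side_meets_nbr] not just at [a]. *)
Lemma leaf_removal_side a b a' b' S U :
  leaf v a b -> leaf v a' b' -> closed_under (~: edges_at v) S -> a \in S -> a' \notin S ->
  closed_under (~: (edges_at a :|: edges_at a')) U -> v \notin U ->
  [disjoint U :&: S & ~: [set a; a']].
Proof.
move=> la la' clS aS a'S clU vU.
have [av _ _ _] := leafP conn oddV bad ev nbr_odd la.
have [a'v _ _ [only' _ _ _]] := leafP conn oddV bad ev nbr_odd la'.
have b'S : b' \notin S by rewrite -(leaf_end_side la' clS).
pose W := (U :&: S) :\: [set a; a'].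
rewrite -setI_eq0 -setDE -/W; apply/negPn/negP => W0.
have vW : v \notin W by rewrite in_setD in_setI (negPf vU) andbF.
have aW : a \notin W by rewrite in_setD set21.
have a'U x : x \in S -> x != a' by apply: contraTneq => ->.
have [||w wW wn] := @side_meets_nbr _ conn oddV bad v ev a W _ vW aW W0 _.
- by case: la.
- move=> e x y; rewrite in_setC in_setU !edges_atE negb_or => /andP[ve ae] xe ye.
  have Sxy : (x \in S) = (y \in S) by apply: (clS e); rewrite // in_setC edges_atE.
  rewrite !in_setD !in_setI -Sxy; case xS: (x \in S); last by rewrite !andbF.
  have yS : y \in S by rewrite -Sxy.
  rewrite !in_set2 (negPf (a'U _ xS)) (negPf (a'U _ yS)) !orbF !andbT.
  have na z : z \in ends e -> z != a by apply: contraTneq => ->; rewrite ae.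
  rewrite !na // (clU e x y) // in_setC in_setU !edges_atE negb_or ae.
  apply/negP => ae'; have := only' e ae'; rewrite (negPf ve) => -[//|b'e].
  have : (x \in S) = (b' \in S) by apply: (clS e); rewrite // in_setC edges_atE.
  by rewrite xS (negPf b'S).
have /nbrP[wv [e ve we]] := wn.
move: wW; rewrite in_setD in_setI in_set2 negb_or => /andP[/andP[wa wa'] /andP[wU _]].
case/negP: vU; rewrite -(clU e w v) // in_setC in_setU !edges_atE negb_or.
have vw : v != w by rewrite eq_sym.
by rewrite (ends_pair ve we vw) !in_set2 !negb_or av a'v eq_sym wa eq_sym wa'.
Qed.

Lemma leaf_removal_connected a b a' b' S U :
  leaf v a b -> leaf v a' b' -> closed_under (~: edges_at v) S -> a \in S -> a' \notin S ->
  closed_under (~: (edges_at a :|: edges_at a')) U -> v \notin U ->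
  [disjoint U & ~: [set a; a']].
Proof.
move=> la la' clS aS a'S clU vU; rewrite -(setID U S).
rewrite disjoints_subset subUset -!disjoints_subset.
rewrite (leaf_removal_side la la' clS aS a'S clU vU) /= setDE setUC.
apply: (leaf_removal_side la' la (closedC clS)); rewrite ?in_setC ?aS //.
by rewrite setUC.
Qed.

(** An edge [e] from [v] to [a] gets color 4 and color 1 omits [a]. As
    [G - a - a'] is connected, the forest [F] can be chosen without edges at
    [a']. The edges to be shared are then either [F] and the edges at [a] other
    than [e], or these together with two parallel edges [p1], [p2] between [v] and [a'].
    A split cycle of either choice that is not empty contains all edges at [v]
    and [a], and is therefore unique. The two cycles differ by [p1] and [p2],
    so that exactly one more vertex, [a'], is touched in the second case, and
    at most one of the two choices is obstructed. *)
Lemma leaf_separated a b a' b' S :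
  leaf v a b -> leaf v a' b' -> closed_under (~: edges_at v) S ->
  a \in S -> a' \notin S -> False.
Proof.
move=> la la' clS aS a'S.
have [av bv ba [only par va_pos evav]] := leafP conn oddV bad ev nbr_odd la.
have [a'v b'v ba'' [only' par' va'_pos evav']] := leafP conn oddV bad ev nbr_odd la'.
have bS : b \in S by rewrite -(leaf_end_side la clS).
have b'S : b' \notin S by rewrite -(leaf_end_side la' clS).
have neS x y : x \in S -> y \notin S -> x != y by move=> xS; apply: contraNneq => <-.
have aa' := neS _ _ aS a'S; have ab' := neS _ _ aS b'S.
have ba' := neS _ _ bS a'S.
have apart := leaves_apart conn oddV bad ev nbr_odd la la' aa' ba'.
have apart' e : a' \in ends e -> a \notin ends e.
  by move=> ae'; apply: contraL ae' => /apart.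
pose D0 := ~: (edges_at a :|: edges_at a'); pose Z := ~: [set a; a'; b'].
have Zs : Z \subset ~: [set a; a'] by rewrite setCS subsetUl.
have [F [Fs acF oddF]] : exists F, [/\ F \subset D0, acyclic F
    & forall x, odd (deg (D0 :\: F) x) = (x \in Z)].
  apply: parity_subgraph => U clU.
  have [vU|vU] := boolP (v \in U); last first.
    have := leaf_removal_connected la la' clS aS a'S clU vU.
    move=> /(disjointWr Zs); rewrite -setI_eq0 => /eqP->.
    by rewrite cards0.
  have := @leaf_removal_connected _ _ _ _ _ (~: U) la la' clS aS a'S (closedC clU).
  rewrite in_setC vU => /(_ isT)/(disjointWr Zs).
  rewrite disjoints_subset setCS => /setIidPr->.
  have cE : #|[set a; a'; b']| = 3.
    by rewrite setUC cardsU1 cards2 aa' in_set2 negb_or eq_sym ab' (negPf ba'').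
  by move: oddV; rewrite -(cardsC [set a; a'; b']) cE oddD.
have /deg_gt0P[e ea vE] := va_pos; rewrite edges_atE in ea.
have [an _ _ _] := la; have [a'n _ _ _] := la'.
have parallel := bad_parallel conn oddV bad ev.
have ev_e : e \in edges_at v by rewrite edges_atE.
have [g [ge vg ag]] := parallel _ an _ ev_e ea.
have /deg_gt0P[p1 p1a vp1] := va'_pos; rewrite edges_atE in p1a.
have ev_p1 : p1 \in edges_at v by rewrite edges_atE.
have [p2 [p21 vp2 p2a]] := parallel _ a'n _ ev_p1 p1a.
have va : v != a by rewrite eq_sym.
have va' : v != a' by rewrite eq_sym.
have eE := ends_pair vE ea va; have gE := ends_pair vg ag va.
have p1E := ends_pair vp1 p1a va'; have p2E := ends_pair vp2 p2a va'.
pose Pp := [set p1; p2]; pose D' := F :|: edges_at a :\ e.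
have degP x : deg Pp x = (x \in [set v; a']).*2.
  by rewrite degU ?deg1 ?p1E ?p2E ?addnn // disjoints1 in_set1 eq_sym.
have evP : even_set Pp by apply/even_setP => x; rewrite degP odd_double.
have PpE h : h \in Pp -> ends h = [set v; a'].
  by rewrite in_set2 => /orP[]/eqP->.
have nF h : h \in F -> a \notin ends h /\ a' \notin ends h.
  by move/(subsetP Fs); rewrite in_setC in_setU !edges_atE negb_or => /andP[-> ->].
have D'a' h : h \in D' -> a' \notin ends h.
  rewrite in_setU in_setD1 edges_atE => /orP[/nF[]//|/andP[_ /apart]//].
have dP : [disjoint D' & Pp].
  rewrite disjoint_sym disjoints_subset; apply/subsetP => h /PpE hE.
  by rewrite in_setC; apply/negP => /D'a'; rewrite hE set22.
have dF : [disjoint F & edges_at a :\ e].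
  rewrite disjoints_subset; apply/subsetP => h /nF[ah _].
  by rewrite in_setC in_setD1 edges_atE (negPf ah) andbF.
have eD' : e \notin D'.
  rewrite in_setU in_setD1 eqxx orbF; apply/negP => /nF[]; rewrite ea //.
have eP : e \notin Pp by apply: contraL (apart e ea) => /PpE->; rewrite negbK set22.
have ea1 : [set e] \subset edges_at a by rewrite sub1set edges_atE.
have oddH' x : odd (deg (~: (D' :|: [set e])) x) = (x != a).
  have -> : ~: (D' :|: [set e]) = edges_at a' :|: (D0 :\: F).
    apply/setP => h; rewrite /D0 !(in_setC, in_setU, in_setD, in_set1, edges_atE).
    have [->|he] := eqVneq h e.
      by rewrite !orbT ea (negPf (apart e ea)) !andbF.
    have := @nF h; have := apart h.
    case: (h \in F); case: (a \in ends h); case: (a' \in ends h) => //= h1 h2;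
      by [have := h1 isT | have [] := h2 isT].
  rewrite degU; last first.
    rewrite disjoints_subset; apply/subsetP => h; rewrite edges_atE => ah.
    by rewrite in_setC in_setD /D0 in_setC in_setU !edges_atE ah orbT andbF.
  rewrite oddD par' oddF in_setC !in_setU !in_set1.
  have [->|xa] := eqVneq x a; first by rewrite (negPf aa') (negPf ab').
  by case: (x == a'); case: (x == b').
have PpH : Pp \subset ~: (D' :|: [set e]).
  rewrite subsetC; apply/subsetP => h; rewrite in_setU in_set1 in_setC.
  by case/orP=> [hD|/eqP->//]; rewrite (disjointFr dP).
have dD'v : deg D' v = deg F v + deg (edges_at a :\ e) v by rewrite degU.
have oddD'v : ~~ odd (deg D' v).
  have := ev; rewrite (degB v (subsetT (D' :|: [set e]))) setTD oddD oddH' va.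
  by rewrite degU 1?disjoint_sym ?disjoints1 // deg1 vE oddD addbT negbK; case: odd.
have gD' : g \in D' by rewrite in_setU in_setD1 ge edges_atE ag orbT.
have D'a : deg D' a = (d a).-1.
  rewrite degU // [deg F a]deg_eq0; last by move=> h /nF[].
  by rewrite -deg_edges_at (degB a ea1) deg1 ea.
have evD'a : ~~ odd (deg D' a).
  by have := nbr_odd an; rewrite D'a; case: (d a).
pose Dq Q := D' :|: Q.
(* [Q] is [set0] or [Pp]. *)
have key Q : Q \subset Pp -> even_set Q ->
    [/\ v \in evenpos (Dq Q), a \in evenpos (Dq Q) &
     forall F0, split_cycle (Dq Q) F0 -> F0 = set0 \/ edges_at a :\ e :|: Q \subset F0].
  move=> QP Qe; have dQ : [disjoint D' & Q] by apply: disjointWr dP.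
  have Qv h : h \in Q -> ends h = [set v; a'] by move/(subsetP QP)/PpE.
  have vP : v \in evenpos (Dq Q).
    rewrite inE degU // oddD (negPf oddD'v) (negPf (even_setP _ Qe v)) andbT addn_gt0.
    by apply/orP; left; apply/deg_gt0P; exists g.
  have aP : a \in evenpos (Dq Q).
    rewrite inE degU // oddD (negPf evD'a) (negPf (even_setP _ Qe a)) andbT addn_gt0.
    by apply/orP; left; apply/deg_gt0P; exists g.
  split=> // F0 /and3P[F0s F0e /forall_inP allF0].
  have gQ : g \in Dq Q by rewrite in_setU gD'.
  case/orP: (allF0 v vP) => [sub|dis]; [right|left].
    rewrite subUset; apply/andP; split; last first.
      by apply/subsetP => h hQ; apply: (subsetP sub); rewrite starE in_setU hQ orbT Qv ?set21.
    case/orP: (allF0 a aP) => [sub'|dis'].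
      apply/subsetP => h; rewrite in_setD1 edges_atE => /andP[he ah].
      by apply: (subsetP sub'); rewrite starE ah andbT !in_setU in_setD1 he edges_atE ah orbT.
    have := disjointFr dis' (_ : g \in _); rewrite starE gQ ag => /(_ isT).
    by rewrite (subsetP sub) // starE gQ vg.
  case/orP: (allF0 a aP) => [sub'|dis'].
    have := disjointFr dis (_ : g \in _); rewrite starE gQ vg => /(_ isT).
    by rewrite (subsetP sub') // starE gQ ag.
  apply: acF F0e; apply/subsetP => h hF0; have := subsetP F0s h hF0.
  rewrite !in_setU => /orP[/orP[//|]|hQ].
    rewrite in_setD1 edges_atE => /andP[he ah].
    have := disjointFl dis' hF0.
    by rewrite starE ah andbT !in_setU in_setD1 he edges_atE ah orbT.
  have := disjointFl dis hF0.
  by rewrite starE in_setU hQ orbT Qv // set21.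
have touch4 Q : Q \subset Pp -> even_set Q ->
    (forall F0, split_cycle (Dq Q) F0 -> ~~ odd #|touched (Dq Q) F0|) -> False.
  move=> QP Qe cyc; apply: bad; have [vP aP _] := key Q QP Qe.
  have QH : Q \subset ~: (D' :|: [set e]) by apply: subset_trans PpH.
  apply: (almost3_decomposition (D := Dq Q) (Y := [set e])) => //.
  - by rewrite cards1.
  - by rewrite disjoints1 in_setU negb_or eD'; apply: contra eP => /(subsetP QP).
  - have -> : ~: (Dq Q :|: [set e]) = ~: (D' :|: [set e]) :\: Q.
      by rewrite /Dq setUAC setCU setDE.
    apply/forallP => x; have := oddH' x; rewrite (degB x QH) oddD.
    rewrite (negPf (even_setP _ Qe x)) /= => ->.
    have [->|] := eqVneq x a; last by rewrite orbT.
    rewrite deg_eq0 // => h; rewrite in_setD in_setC !in_setU !negb_or in_setD1 in_set1 edges_atE.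
    by case/andP => _ /andP[/andP[_]]; case: (h == e); case: (a \in ends h).
  move=> h /set1P->; right; rewrite eE subUset !sub1set vP aP //.
have s0 : set0 \subset Pp by apply: sub0set.
case: (boolP [forall F0, split_cycle (Dq set0) F0 ==> ~~ odd #|touched (Dq set0) F0|]).
  move=> /forallP cyc; apply: (touch4 set0 s0 (even_set0 G)) => F0.
  exact: (implyP (cyc F0)).
move=> /forallPn[F0]; rewrite negb_imply negbK => /andP[cyc0 odd0].
have [vP0 aP0 /(_ _ cyc0)[F00|aF0]] := key set0 s0 (even_set0 G).
  by rewrite F00 touched0 cards0 in odd0.
rewrite setU0 in aF0; have /and3P[F0s F0e /forall_inP allF0] := cyc0.
have D'E : Dq set0 = D' by rewrite /Dq setU0.
rewrite D'E in cyc0 odd0 vP0 aP0 F0s allF0.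
have dF0P : [disjoint F0 & Pp] by apply: disjointWl dP.
have F1e : even_set (F0 :|: Pp) by apply: even_setU.
have [vP aP keyP] := key Pp (subxx _) evP.
have degD x : deg (Dq Pp) x = deg D' x + (x \in [set v; a']).*2 by rewrite degU // degP.
have evenposE x : x != a' -> (x \in evenpos (Dq Pp)) = (x \in evenpos D').
  move=> xa'; have [->|xv] := eqVneq x v; first by rewrite vP vP0.
  by rewrite [LHS]in_set [RHS]in_set degD in_set2 (negPf xv) (negPf xa') addn0.
have D'a'0 : deg D' a' = 0 by apply: deg_eq0 => h /D'a'.
have a'P : a' \in evenpos (Dq Pp) by rewrite inE degD D'a'0 set22.
have ge0 : g \in F0.
  by apply: (subsetP aF0); rewrite in_setD1 ge edges_atE ag.
have starP x : x \notin [set v; a'] -> star (Dq Pp) x = star D' x.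
  move=> xva; apply/setP => h; rewrite !starE in_setU; case hP: (h \in Pp); rewrite ?orbF //.
  by rewrite (PpE h hP) (negPf xva) !andbF.
(* The obstruction of the first choice, extended by [Pp], is a split cycle of the second. *)
have cyc1 : split_cycle (Dq Pp) (F0 :|: Pp).
  apply/and3P; split=> //; first by rewrite setSU.
  apply/forall_inP => x xP; have [xa'|xa'] := eqVneq x a'.
    apply/orP; left; apply/subsetP => h; rewrite starE xa' => /andP[hD a'h].
    by case/setUP: hD => [/D'a'/negP//|hP]; rewrite in_setU hP orbT.
  have := allF0 x; rewrite -evenposE // => /(_ xP).
  have [->|xv] := eqVneq x v.
    case/orP => [sub|dis]; last first.
      by have := disjointFl dis ge0; rewrite starE gD' vg.
    apply/orP; left; apply/subsetP => h; rewrite starE => /andP[/setUP[hD|hP] vh].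
      by rewrite in_setU (subsetP sub) // starE hD.
    by rewrite in_setU hP orbT.
  have xva : x \notin [set v; a'] by rewrite in_set2 negb_or xv.
  rewrite starP // => /orP[sub|dis]; apply/orP; [left|right].
    by apply: subset_trans sub _; apply: subsetUl.
  rewrite disjoints_subset setCU subsetI -disjoints_subset dis /=.
  apply/subsetP => h; rewrite starE in_setC => /andP[hD _].
  by rewrite (disjointFr dP hD).
have touchE : touched (Dq Pp) (F0 :|: Pp) = a' |: touched D' F0.
  apply/setP => x; rewrite in_setU1 in_set degU // degP.
  have [->|xa'] := eqVneq x a'; first by rewrite a'P set22 addn2.
  rewrite evenposE // [x \in touched _ _]in_set /=; congr (_ && _).
  have [->|xv] := eqVneq x v; last by rewrite in_set2 (negPf xv) (negPf xa') addn0.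
  by rewrite set21 addn2 ltn0Sn; apply/esym/deg_gt0P; exists g.
apply: (touch4 Pp (subxx _) evP) => F2 cyc2.
have [->|sub2] := keyP F2 cyc2; first by rewrite touched0 cards0.
have /and3P[F2s F2e _] := cyc2; have /and3P[F1s _ _] := cyc1.
have DqF A : edges_at a :\ e :|: Pp \subset A -> Dq Pp \subset A :|: F.
  move=> sA; rewrite /Dq /D' -setUA subUset subsetUr /=.
  by apply: subset_trans sA _; apply: subsetUl.
have -> : F2 = F0 :|: Pp.
  apply: (acyclic_unique acF) => //; rewrite subDset.
    by apply: subset_trans F2s _; apply: DqF; rewrite setSU.
  by apply: subset_trans F1s _; apply: DqF.
rewrite touchE cardsU1 /= oddD odd0 [a' \in _]in_set [a' \in _]in_set D'a'0.
by [].
Qed.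
End Separated.

(** * Conclusion *)

Lemma connected_indecomposable (G : mgraph) : connected_graph G -> indecomposable G.
Proof.
move=> conn U clU; have [->|/set0Pn[x xU]] := eqVneq U set0; [by left | right].
have cl : closed (@adjacent G) (mem U).
  move=> y z /set0Pn[e]; rewrite inE => /eqP eE.
  by apply: (clU e); rewrite ?inE ?eE ?set21 ?set22.
by apply/setP => y; rewrite inE -(closed_connect cl (conn x y)).
Qed.

(** The statement is a quantification over finite types, hence decidable. *)
Lemma almost3_stable (G : mgraph) : ~ ~ almost3 G -> almost3 G.
Proof.
pose single (phi : {ffun edge G -> 'I_4}) (e : edge G) :=
  [&& odd_edge_coloring phi, [forall f, (phi f == color4) == (f == e)] &
   [exists c : 'I_4, (c != color4) && [forall v in ends e,
     [exists f, (v \in ends f) && (phi f == c)]]]].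
have singleP phi e : reflect (single_edge_coloring phi e) (single phi e).
  apply: (iffP and3P) => -[oddP only common]; split=> //.
  - by move=> f; move/eqP: (forallP only f) => fE; split=> /eqP; [rewrite fE | rewrite -fE] => /eqP.
  - have /existsP[c /andP[c4 /forall_inP cP]] := common; exists c => // v /cP.
    by case/existsP => f /andP[vf /eqP fc]; exists f.
  - by apply/forallP => f; apply/eqP; apply/eqP/eqP => /only.
  have [c c4 cP] := common; apply/existsP; exists c; rewrite c4.
  apply/forall_inP => v /cP[f vf fc]; apply/existsP; exists f.
  by rewrite vf fc eqxx.
move=> nng; have [|no3] := boolP (odd_edge_colorable G 3); first by left.
have [/existsP[phi /existsP[e /singleP]]|no] := boolP [exists phi, exists e, single phi e].
  by right; exists phi, e.
case: nng => -[|[phi [e /singleP s]]]; first exact/negP.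
by case/existsP: no; exists phi; apply/existsP; exists e.
Qed.

Lemma connected_almost3 (G : mgraph) : connected_graph G ->
  ~ shannon_type G 2 2 2 -> ~ shannon_type G 2 2 1 -> almost3 G.
Proof.
move=> /connected_indecomposable conn no222 no221; apply: almost3_stable => bad.
have oddV : odd #|vertex G|.
  by apply/negPn/negP => evV; apply: bad; apply: almost3_even_order.
have [v ev] : exists v, ~~ odd (deg [set: edge G] v).
  apply/existsP; apply: contraLR oddV => /existsPn allodd.
  have clT : closed_under [set: edge G] setT by move=> e x y; rewrite !in_setT.
  have := closed_odd_vertices clT; congr (~~ odd _); rewrite -cardsT.
  by apply: eq_card => x; rewrite !inE (negbNE (allodd x)).
have nbr_odd x : x \in nbr v -> odd (deg [set: edge G] x).
  exact: bad_even_nbr.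
have leafP' := leafP conn oddV bad ev nbr_odd.
have cutP := cut_exists conn oddV bad ev nbr_odd.
have leaf_in := leaf_in_cut conn oddV bad ev nbr_odd.
have otherP := nbr_other conn oddV bad ev nbr_odd.
have separated := leaf_separated conn oddV bad ev nbr_odd.
have [x0 x0n] : exists x, x \in nbr v.
  have [/existsP//|/existsPn no] := boolP [exists x, x \in nbr v].
  exfalso; apply: bad.
  have noE (e : edge G) : False.
    have clv : closed_under [set: edge G] [set v].
      move=> f x y _ xf yf; rewrite !in_set1.
      have imp z w : z \in ends f -> w \in ends f -> z == v -> w == v.
        move=> zf wf /eqP zv; apply/negPn/negP => wv.
        by case/negP: (no w); apply/nbrP; split=> //; exists f; rewrite -?zv.
      by apply/idP/idP; apply: imp.
    have [|vE] := conn _ clv.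
      by move/setP/(_ v); rewrite !inE eqxx.
    have := subset_leq_card (subsetT (ends e)).
    by rewrite card_ends -vE cards1.
  apply: (almost3_decomposition (D := set0) (Y := set0)).
  - by rewrite cards0.
  - by rewrite disjoints_subset sub0set.
  - by apply/forallP => x; rewrite deg_eq0 // => e; case: (noE e).
  - move=> F0 /and3P[F0s _ _]; rewrite (_ : F0 = set0) ?touched0 ?cards0 //.
    by apply/eqP; rewrite -subset0.
  by move=> e; case: (noE e).
have [y0 y0n y0v] := otherP _ x0n.
have [U0 c0] := cutP _ _ x0n y0n y0v.
have [a [b [_ la]]] := leaf_in _ _ _ x0n c0.
have [an ban bv nba] := la.
have [U1 c1] := cutP _ _ an ban bv.
have [a' [b' [a'U1 la']]] := leaf_in _ _ _ an c1.
have [a'n b'an b'v nba'] := la'.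
have aa' : a != a' by apply: contraTneq a'U1 => <-; have [] := c1.
have nosep U : closed_under (~: edges_at v) U -> (a \in U) = (a' \in U).
  move=> clU; apply/idP/idP => [aU|a'U]; apply/negPn/negP => no.
    exact: separated la la' clU aU no.
  exact: separated la' la clU a'U no.
have [ba'|ba'] := eqVneq b a'; last first.
  exact: leaf_same_side conn oddV bad v ev nbr_odd _ _ _ _ la la' aa' ba' nosep.
(* The two leaves are adjacent and form a component of [G - v]. *)
have b'a : b' = a.
  have : a \in nbr a' by rewrite nbrC -ba'.
  by case/nba' => // av; move: an; rewrite av inE eqxx.
have av : a != v by case/nbrP: an.
have a'v : a' != v by case/nbrP: a'n.
pose W := ~: [set v; a; a'].
have clW : closed_under (~: edges_at v) W.
  have imp e x y : v \notin ends e -> x \in ends e -> y \in ends e -> x \notin W -> y \notin W.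
    rewrite !in_setC !negbK !in_setU !in_set1 -!orbA => ve xe ye.
    have [->//|xy] := eqVneq y x.
    case/or3P => /eqP xE; rewrite xE in xe xy.
    - by rewrite xe in ve.
    - have /nba[->|->] : y \in nbr a by apply/nbrP; split=> //; exists e.
        by rewrite eqxx.
      by rewrite ba' eqxx !orbT.
    have /nba'[->|->] : y \in nbr a' by apply/nbrP; split=> //; exists e.
      by rewrite eqxx.
    by rewrite b'a eqxx !orbT.
  move=> e x y; rewrite in_setC edges_atE => ve xe ye.
  by apply/idP/idP; apply: contraLR; [exact: (imp e y x)|exact: (imp e x y)].
have aW : a \notin W by rewrite in_setC negbK !in_setU !in_set1 eqxx orbT.
have vW : v \notin W by rewrite in_setC negbK !in_setU !in_set1 eqxx.
(* Another component of [G - v] contains a third leaf, which is separated from [a]. *)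
have [W0|W0] := eqVneq W set0; last first.
  have [|w wW wn] := @side_meets_nbr _ conn oddV bad v ev a W an vW aW W0.
    by apply: closedS clW; rewrite setCS subsetUl.
  have wv : w != v by case/nbrP: wn.
  have [y yn yv] := otherP _ wn; have [U [vU wU yU clU]] := cutP _ _ wn yn yv.
  have yW : y \in W.
    have /nbrP[yw [e we ye]] := yn; have wy : w != y by rewrite eq_sym.
    rewrite -(clW e w y) // in_setC edges_atE (ends_pair we ye wy) in_set2 negb_or.
    by rewrite eq_sym wv eq_sym yv.
  have cUW : cut v w y (U :&: W).
    split; rewrite ?in_setI ?(negPf vU) ?(negPf wU) ?yU //.
    move=> e p q eD pe qe; rewrite !in_setI (clU e p q) // (clW e p q) //.
    by move: eD; rewrite in_setD => /andP[].
  have [a3 [b3 [a3U la3]]] := leaf_in _ _ _ wn cUW.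
  apply: (separated _ _ _ _ _ la3 la clW _ aW).
  by move: a3U; rewrite in_setI => /andP[].
have VE : [set v; a; a'] = setT by rewrite -[LHS]setCK -/W W0 setC0.
have adj x y : y \in nbr x -> adjacent x y by rewrite nbr_adjacent => /andP[].
have [_ _ _ [_ para _ _]] := leafP' _ _ la.
have evinc := even_setP _ (bad_even_edges_at conn oddV bad ev).
have va : v != a by rewrite eq_sym.
have va' : v != a' by rewrite eq_sym.
have bC x y : bouquet x y = bouquet y x :> {set edge G}.
  by apply/setP => e; rewrite !inE setUC.
have a'a : a' \in nbr a by rewrite -ba'.
apply: no221; split=> //.
- split; first by rewrite -cardsT -VE -setUA cardsU1 cards2 !inE negb_or va va' aa'.
  move=> x y; have : x \in [set v; a; a'] by rewrite VE.
  have : y \in [set v; a; a'] by rewrite VE.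
  rewrite !in_setU !in_set1 -!orbA => /or3P[]/eqP-> /or3P[]/eqP->; rewrite ?eqxx // => _;
    by apply: adj; rewrite // nbrC.
exists a, v, a'; split.
- by rewrite /= !inE negb_or av aa' va'.
- by rewrite /parity_code bC -deg_edges_at_bouquet // (negPf (evinc a)).
- by rewrite /parity_code -deg_edges_at_bouquet // (negPf (evinc a')).
by rewrite /parity_code -deg_edges_at_bouquet // para -ba' set22.
Qed.

(** Color 4 is not used any more. *)
Lemma delete_edge_colorable3 (G : mgraph) (phi : {ffun edge G -> 'I_4}) e :
  single_edge_coloring phi e -> odd_edge_colorable (delete_edge e) 3.
Proof.
case=> phiP only _; pose psi := [ffun f : edge (delete_edge e) => phi (val f)].
have psi4 f : psi f != color4.
  by rewrite ffunE; apply: contra (valP f) => /eqP/only->.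
apply/odd_edge_colorableP; exists 'I_4, psi; split; last first.
  have : [set psi f | f : edge (delete_edge e)] \subset [set~ color4].
    by apply/subsetP => c /imsetP[f _ ->]; rewrite !inE.
  by move/subset_leq_card; rewrite cardsC1 card_ord.
apply/forallP => v; apply/forallP => c; have [->|c4] := eqVneq c color4.
  apply/orP; left; rewrite cards_eq0; apply/eqP/setP => f.
  by rewrite !inE (negPf (psi4 f)) andbF.
suff -> : color_degree psi v c = color_degree phi v c by apply: (forallP (forallP phiP v) c).
rewrite /color_degree -(card_imset _ val_inj); apply: eq_card => f.
apply/imsetP/idP => [[f' f'P ->]|].
  by move: f'P; rewrite !inE ffunE.
rewrite inE => /andP[vf fc]; have fe : f != e.
  by apply: contra c4 => /eqP fe; rewrite -(eqP fc) fe; apply/eqP/only.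
by exists (Sub f fe); rewrite ?inE ?ffunE ?SubK ?vf.
Qed.

(** The additional color is [None], given to [e] only. *)
Lemma colorable_delete_edge (G : mgraph) (e : edge G) k :
  odd_edge_colorable (delete_edge e) k -> odd_edge_colorable G k.+1.
Proof.
case/existsP => psi psiP; pose phi := [ffun f => omap psi (insub f)].
apply/odd_edge_colorableP; exists (option 'I_k), phi; split; last first.
  by apply: leq_trans (max_card _) _; rewrite card_option card_ord.
apply/forallP => v; apply/forallP => -[c|]; last first.
  have : color_degree phi v None <= 1.
    rewrite -(cards1 e); apply/subset_leq_card/subsetP => f.
    by rewrite !inE ffunE; case: insubP => [? _ _|]; rewrite ?andbF // negbK => ->.
  by case: color_degree => [|[]].
suff -> : color_degree phi v (Some c) = color_degree psi v c.
  exact: (forallP (forallP psiP v) c).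
rewrite /color_degree -[RHS](card_imset _ val_inj); apply: eq_card => f.
apply/idP/imsetP => [|[f' f'P ->]].
  rewrite !inE ffunE; case: insubP => [f' _ <-|_] /andP[vf fc] //.
  by exists f'; rewrite // !inE vf.
by move: f'P; rewrite !inE ffunE valK.
Qed.

Theorem theorem1p3 (G : mgraph) :
  connected_graph G ->
  ~ shannon_type G 2 2 2 ->
  ~ shannon_type G 2 2 1 ->
  (odd_edge_colorable G 3 \/
   exists (phi : {ffun edge G -> 'I_4}) (e : edge G),
     single_edge_coloring phi e) /\
  (~ odd_edge_colorable G 3 ->
   forall (phi : {ffun edge G -> 'I_4}) (e : edge G),
     single_edge_coloring phi e ->
     odd_chromatic_index (delete_edge e) = 3).
Proof.
move=> conn no222 no221; split; first exact: connected_almost3.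
move=> no3 phi e phiP; rewrite /odd_chromatic_index; case: ex_minnP => k kP kmin.
have k3 := kmin _ (delete_edge_colorable3 phiP).
apply/eqP; rewrite eqn_leq k3 leqNgt; apply/negP => k2; apply: no3.
have /odd_edge_colorableP[S [psi [psiP Sk]]] := colorable_delete_edge kP.
by apply/odd_edge_colorableP; exists S, psi; split; rewrite ?(leq_trans Sk).
Qed.
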